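(* Let $\mathcal S=\{S_1,\dots,S_m\}$ be a system of injective contractions of a complete metric space whose attractor $K$ is a self-similar dendrite with finite self-similar boundary $P=\partial K$ and whose $P$-sprout $\Gamma$ is regular, and let $\hat\gamma$ be the main tree of $K$. For any $x\in K$, the set $A_x=\{\alpha\in\pi^{-1}(x): N_\phi(\alpha)>1\}$ is finite, and $A_x=\varnothing$ if and only if $x\notin\hat\gamma$. Moreover: 1) If $A_x=\{\alpha\}$ and $x\notin\partial K$, then $\mathrm{Ord}(x,\hat\gamma)=N_\phi(\alpha)$. 2) If $A_x=\{\alpha\}$ and $x\in\partial K$, then $\mathrm{Ord}(x,\hat\gamma)=N_\phi(\alpha)-1$. 3) If $\#A_x>1$, then $\mathrm{Ord}(x,\hat\gamma)=\sum_{\alpha\in A_x}(N_\phi(\alpha)-1)$.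
   Context: The attractor $K$ of $\mathcal S$ is the unique nonempty compact set with $K=\bigcup_{i=1}^m S_i(K)$. Write $I=\{1,\dots,m\}$, $I^*=\bigcup_{n\ge1}I^n$, $S_{\mathbf j}=S_{j_1}\circ\dots\circ S_{j_n}$, $K_{\mathbf j}=S_{\mathbf j}(K)$. The index map $\pi:I^\infty\to K$ sends $\alpha=\alpha_1\alpha_2\ldots$ to the unique point of $\bigcap_n K_{\alpha_1\dots\alpha_n}$; elements of $\pi^{-1}(x)$ are the addresses of $x$. The critical set is $\mathcal C=\bigcup_{i\ne j}K_i\cap K_j$, and the self-similar boundary $\partial K$ is the set of all $x\in K$ with $S_{\mathbf i}(x)\in\mathcal C$ for some $\mathbf i\in I^*$. $K$ is a self-similar dendrite if it is a locally connected continuum containing no simple closed curve. The main tree $\hat\gamma$ is the smallest subdendrite of $K$ containing $\partial K$. For a subdendrite $D$ and $x\in D$, $\mathrm{Ord}(x,D)$ is the number of connected components of $D\setminus\{x\}$. $P$-sprout of $\mathcal S$ ($P=\partial K$): the edge-labeled bipartite graph $\Gamma=(W,B,E,\varphi)$ with white vertices $W=\{w_1,\dots,w_m\}$ ($w_i$ standing for $K_i$), black vertices $B=\mathcal C\cup P$, an edge $e=(w_i,b)$ exactly when $b\in K_i$, and label $\varphi(e)=S_i^{-1}(b)\in P$. Under the assumptions it is a tree. It is regular if every vertex in $W$ and every vertex in $B\setminus P$ has degree greater than $1$. Maps $\phi$: for $i\in I$ define $\phi_i:P\to P$ by $\phi_i(p)=\varphi(e)$, where $e$ is the last edge (the one incident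 to $w_i$) of the unique path in $\Gamma$ from $p$ to $w_i$. For $\mathbf j=j_1\dots j_k\in I^*$ put $\phi_{\mathbf j}=\phi_{j_k}\circ\dots\circ\phi_{j_1}$. For $\alpha=j_1j_2\ldots\in I^\infty$ let $\alpha|_n=j_1\dots j_n$; the numbers $\#\phi_{\alpha|_n}(P)$ are non-increasing in $n$, and $N_\phi(\alpha)=\lim_{n\to\infty}\#\phi_{\alpha|_n}(P)=\min_n\#\phi_{\alpha|_n}(P)\ge1$. *)

(* Defs.v *)
From HB Require Import structures.
From mathcomp Require Import all_boot all_order all_algebra finmap.
From mathcomp Require Import all_classical all_reals all_analysis.

Set Implicit Arguments.
Unset Strict Implicit.
Unset Printing Implicit Defensive.

Import Order.TTheory GRing.Theory Num.Theory.
Import numFieldTopology.Exports.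

Local Open Scope classical_set_scope.
Local Open Scope ring_scope.
Local Open Scope card_scope.

#[short(type="completeMetricType")]
HB.structure Definition CompleteMetric (R : numDomainType) :=
  {T of Metric R T & Complete T}.

Section topology.
Context {R : realType} {X : metricType R}.
Implicit Types (f : X -> X) (A D : set X).

(* The library's [is_contraction] is only available on normed modules. *)
Definition contractive f :=
  exists q : R, 0 <= q < 1 /\ forall x y, mdist (f x) (f y) <= q * mdist x y.

(* The sets [A `&` V] with [V] open are the open sets of the subspace [A]. *)
Definition locally_connected A :=
  forall x (U : set X), A x -> open U -> U x ->
    exists V : set X,
      [/\ open V, V x, A `&` V `<=` U & connected (A `&` V)].

Definition simple_closed_curve A :=
  exists f : R -> X,
    [/\ {within `[0, 1], continuous f}, f 0 = f 1,
        {in `[0, 1[ &, injective f} & A = f @` `[0, 1]].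

Definition continuum A := [/\ A !=set0, compact A & connected A].

Definition dendrite A :=
  [/\ continuum A, locally_connected A
    & forall L, simple_closed_curve L -> ~ (L `<=` A)].

Definition subdendrite A D := D `<=` A /\ dendrite D.

Definition components A : set (set X) := connected_component A @` A.

(* [fset_set] sends infinite sets to the empty set, so [Ord x D = n] with
   [0 < n] entails that [D `\ x] has finitely many components. *)
Definition Ord x D : nat := #|` fset_set (components (D `\ x))|.

End topology.

Section self_similar.
Context {R : realType} {X : metricType R} {m : nat}.
Variables (S : 'I_m -> X -> X) (K : set X).
Implicit Types (i : 'I_m) (j : seq 'I_m) (a : nat -> 'I_m) (x p b : X).

Definition attractor :=
  [/\ K !=set0, compact K & K = \bigcup_i (S i @` K)].

(* [S_word [:: j_1; ...; j_n] = S j_1 \o ... \o S j_n] *)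
Definition S_word j x : X := foldr S x j.

Definition piece j : set X := S_word j @` K.

Definition word a n : seq 'I_m := mkseq a n.

(* [pi(a) = x], the index map being seen as a functional relation. *)
Definition index_map a x := \bigcap_n piece (word a n) = [set x].

Definition addresses x : set (nat -> 'I_m) := [set a | index_map a x].

Definition critical : set X :=
  \bigcup_i \bigcup_(k in [set k | k != i]) (piece [:: i] `&` piece [:: k]).

Definition boundary : set X :=
  [set x | K x /\ exists2 j, j != [::] & critical (S_word j x)].

Definition main_tree (G : set X) :=
  [/\ subdendrite K G, boundary `<=` G
    & forall D, subdendrite K D -> boundary `<=` D -> G `<=` D].

(* The sprout: [inl i] is the white vertex [w_i], [inr b] the black vertex [b];
   [inr b] is a vertex only when [black b]. *)
Definition black : set X := critical `|` boundary.

Definition sprout_edge i b := black b /\ piece [:: i] b.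

Definition adjacent (u v : 'I_m + X) : Prop :=
  match u, v with
  | inl i, inr b | inr b, inl i => sprout_edge i b
  | _, _ => False
  end.

(* The label of the edge [(w_i, b)], i.e. the inverse image of [b] under the
   injective map [S i]; the default value is only used off the edges. *)
Definition label i b : X := xget b (S i @^-1` [set b]).

(* [`I_2 #<= A] says that [A] has at least two elements. *)
Definition regular :=
  (forall i, `I_2 #<= [set v | adjacent (inl i) v]) /\
  (forall b, (black `\` boundary) b -> `I_2 #<= [set v | adjacent (inr b) v]).

(* [(w_i, b)] is the last edge of a simple path of the sprout from [p] to
   [w_i], whose vertices are [inr p, s_1, ..., s_r = inr b, inl i]. *)
Definition last_edge i p b :=
  exists s : seq ('I_m + X),
    [/\ path (fun u v => `[< adjacent u v >]) (inr p) (rcons s (inl i)),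
        uniq (inr p :: rcons s (inl i)) & last (inr p) s = inr b].

(* As the sprout is a tree, there is exactly one [b] with [last_edge i p b]
   when [p] is in the boundary, so that the default value is irrelevant. *)
Definition phi i p : X := label i (xget p (last_edge i p)).

(* [phi_word [:: j_1; ...; j_k] = phi j_k \o ... \o phi j_1] *)
Definition phi_word j p : X := foldl (fun q i => phi i q) p j.

Definition card_phi a n : nat :=
  #|` fset_set (phi_word (word a n) @` boundary)|.

Definition N_phi a : nat := limn (card_phi a).

Definition A_ x : set (nat -> 'I_m) :=
  [set a | addresses x a /\ (1 < N_phi a)%N].

End self_similar.

(* Main.v *)
(* The pieces meet in finitely many points, and K and the connected unions of pieces
   are path connected. If such a union met another piece in two points, two arcs
   would close up into a simple closed curve. Hence each piece has a single gate
   towards every branch of K at it, and sending a branch to its gate is a continuous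
   retraction of K onto the piece. Composed with the inverse of the contraction it
   extends phi_i from the boundary to K, so that N_phi(a) counts, for large n, the
   points onto which the boundary P is retracted in the n-th piece of the address a.

   For x in the main tree G, a component of G \ {x} contains a point of P, since G is
   minimal, and meets all the pieces of exactly one address of x. For large n the
   points of P in a component met by all the pieces of a are retracted to one point of
   that component, and all the other points of P are retracted to x. So N_phi(a) is the
   number of components belonging to a, plus one if x is in P or if some component
   belongs to another address; the three formulas follow by summing over A_x. *)

(* The hypothesis on K excludes only curves that are injective up to their end points, while
   self-similarity yields connectedness. Arcs bridge this gap. Paths in K come from expansions of
   the parameter in base m + 1; Zorn's lemma cuts the loops out of a path, which leaves intervals of
   constancy; a Whitney map, measuring the growing image of the path, then serves as a new parameter
   and removes those intervals. The retractions carry the rest. A connected set that meets a piece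
   is mapped into itself by the retraction onto that piece, so its trace on the piece is connected;
   hence the union of the small pieces at a point cuts every subcontinuum, G in particular, in a
   connected neighbourhood. A connected set that misses a piece is retracted to one point. A
   component of G \ {x} may meet all the pieces at x, so two of its points are first joined by a
   closed connected set inside it, which the small pieces at x miss. Regularity supplies two points
   of P, so that G \ {x} is nonempty. *)
Require Import Defs.
From HB Require Import structures.
From mathcomp Require Import all_boot all_order all_algebra finmap.
From mathcomp Require Import all_classical all_reals all_analysis.
From mathcomp Require Import lra.

Set Implicit Arguments.
Unset Strict Implicit.
Unset Printing Implicit Defensive.

Import Order.TTheory GRing.Theory Num.Theory.
Import numFieldTopology.Exports numFieldNormedType.Exports.

Local Open Scope classical_set_scope.
Local Open Scope ring_scope.
Local Open Scope card_scope.

(** * Paths and loop erasure *)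

Section paths.
Context {R : realType} {X : metricType R}.
Implicit Types (f g : R -> X) (A B : set X) (a b c : X) (r s t u v : R).

Lemma last_in_closed (F : set R) u v : closed F -> F u -> u <= v ->
  exists s, [/\ F s, u <= s <= v & forall w, s < w <= v -> ~ F w].
Proof.
move=> Fcl Fu uv; pose E := F `&` [set w | w <= v].
have Ecl : closed E by apply: closedI => //; exact: closed_le.
have E0 : E !=set0 by exists u.
have supE : has_sup E by split=> //; exists v => w [].
have Es : E (sup E).
  have : closure E (sup E) by apply: closure_sup => //; exact: (proj2 supE).
  by rewrite -(closure_id E).1.
exists (sup E); split; first by case: Es.
- case: (Es) => _ /= ->; rewrite andbT.
  by apply: ub_le_sup => //; exact: (proj2 supE).
- move=> w /andP[sw wv] Fw; have : w <= sup E by apply: ub_le_sup => //; exact: (proj2 supE).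
  by rewrite leNgt sw.
Qed.

Lemma first_in_closed (F : set R) u v : closed F -> F v -> u <= v ->
  exists s, [/\ F s, u <= s <= v & forall w, u <= w < s -> ~ F w].
Proof.
move=> Fcl Fv uv.
have [|||s [Fs /andP[us sv] sP]] := @last_in_closed [set w | F (- w)] (- v) (- u).
- by apply: (preimage_closed (f := fun w : R => - w)) Fcl => x _; exact: oppr_continuous.
- by rewrite /= opprK.
- by rewrite lerN2.
exists (- s); split=> //; first by apply/andP; split; lra.
move=> w /andP[uw ws] Fw; apply: (sP (- w)); last by rewrite /= opprK.
by apply/andP; split; lra.
Qed.

(** Paths are uniformly continuous on the whole line, so that gluing and changing parameters need no
    domain conditions; [clamp_path] extends a path given on the unit interval. *)
Definition ucont f := forall e, 0 < e ->
  exists2 d, 0 < d & forall s t, `|s - t| < d -> mdist (f s) (f t) < e.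

Definition path_in A a b :=
  exists f, [/\ ucont f, f 0 = a, f 1 = b & forall t, A (f t)].

Definition injective01 f :=
  forall s t, 0 <= s <= 1 -> 0 <= t <= 1 -> f s = f t -> s = t.

Definition arc_in A a b :=
  exists f, [/\ ucont f, f 0 = a, f 1 = b, forall t, A (f t) & injective01 f].

Lemma ucont_continuous f : ucont f -> continuous f.
Proof.
move=> fc t; apply/metricType_numDomainType.cvgrPdist_lt => e /fc[d d0 dP].
by apply/nbhs_normP; exists d => //= s ts; exact: dP.
Qed.

Lemma dist_le_eq0 (a b : X) : (forall e, 0 < e -> mdist a b < e) -> a = b.
Proof.
move=> ab; apply: mdist_positivity; apply/eqP; rewrite eq_le mdist_ge0 andbT.
by apply/ler_addgt0Pl => e /ab /ltW; rewrite addr0.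
Qed.

Lemma clamp_path f A :
  (forall e, 0 < e -> exists2 d, 0 < d & forall s t, 0 <= s <= 1 -> 0 <= t <= 1 ->
    `|s - t| < d -> mdist (f s) (f t) < e) ->
  (forall t, 0 <= t <= 1 -> A (f t)) ->
  exists g, [/\ ucont g, forall t, A (g t), forall t, 0 <= t <= 1 -> g t = f t
    & forall t, t <= 0 -> g t = f 0].
Proof.
move=> fc fA; pose cl t := if t < 0 then 0 else if 1 < t then 1 else t.
have cl01 t : 0 <= cl t <= 1.
  by rewrite /cl; case: (ltP t 0) => ?; [lra|case: (ltP 1 t) => ?; lra].
exists (f \o cl); split=> [e /fc[d d0 dP]|t|t t01|t] /=.
- exists d => // s t st; apply: dP => //; apply: le_lt_trans st.
  rewrite /cl; case: (ltP t 0) => ?; case: (ltP s 0) => ?;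
    case: (ltP 1 t) => ?; case: (ltP 1 s) => ?;
    by case: (ger0P (s - t)) => ?; rewrite ?ler_norml; try (apply/andP; split); lra.
- exact: fA.
- by case/andP: t01 => t0 t1; rewrite /cl ltNge t0 /= ltNge t1.
- rewrite le_eqVlt /cl => /predU1P[->|->//].
  by rewrite ltxx ltr10.
Qed.

Lemma compact_chain (F : set (set R)) (K : set R) :
  F !=set0 -> total_on F subset -> (forall U, F U -> open U) -> compact K ->
  K `<=` \bigcup_(U in F) U -> exists2 U, F U & K `<=` U.
Proof.
move=> [U0 FU0] Ftot Fop; rewrite compact_cover => Aco AF.
have [D' D'F AD'] := Aco _ F id Fop AF.
have [U FU UP] : exists2 U, F U & forall V, V \in (D' : seq (set R)) -> V `<=` U.
  have : {subset (D' : seq (set R)) <= F} by move=> V /D'F.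
  elim: (D' : seq (set R)) => [|V s IH] sF; first by exists U0.
  have [|U FU UP] := IH; first by move=> W Ws; apply: sF; rewrite inE Ws orbT.
  have /set_mem FV : V \in F by apply: sF; rewrite inE eqxx.
  have [UV|VU] := Ftot _ _ FU FV.
    exists V => // W; rewrite inE => /predU1P[->//|/UP WU].
    exact: subset_trans UV.
  by exists U => // W; rewrite inE => /predU1P[->//|/UP].
by exists U => // t /AD'[V /= /UP VU /VU].
Qed.

Lemma mdist_lt_split a b c e : mdist a b < e / 2 -> mdist b c < e / 2 -> mdist a c < e.
Proof.
move=> ab bc; apply: le_lt_trans (metric_triangle _ b _) _.
by rewrite [e]splitr ltrD.
Qed.

(* A set of parameters is removable when [f] takes the same value at both ends of
   each of its gaps; by maximality, the values of [f] on the complement of a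
   maximal removable set are repeated only at the ends of a gap. *)
Lemma loop_erasure f A : ucont f -> (forall t, A (f t)) ->
  exists g, [/\ ucont g, g 0 = f 0, g 1 = f 1, forall t, A (g t) &
    forall s u t, 0 <= s <= u -> u <= t <= 1 -> g s = g t -> g u = g s].
Proof.
move=> fc fA; pose P := [set U : set R | [/\ open U, U `<=` [set t | 0 < t < 1]
  & forall s t, s < t -> ~ U s -> ~ U t -> (forall w, s < w < t -> U w) -> f s = f t]].
have [|M [[Mop M01 Mloop] Mmax]] := @Zorn_bigcup _ P.
  move=> F FP Ftot; split.
  - by apply: bigcup_open => U /FP[].
  - by move=> t [U /FP[_ U01 _]]; exact: U01.
  move=> s t st Us Ut stU; apply: dist_le_eq0 => e e0.
  have e20 : 0 < e / 2 by lra.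
  have [d d0 dP] := fc _ e20.
  (* The gap shortened by [n] at both ends is compact, hence inside one member [V] of the chain. The
     gap of [V] around it has ends within [n < d] of [s] and [t], and their common value is close to
     both [f s] and [f t]. *)
  pose n := Num.min (d / 2) ((t - s) / 4).
  have [nd nts n0] : [/\ n < d, n + n < t - s & 0 < n].
    by rewrite /n; case: (leP (d / 2) ((t - s) / 4)) => ?; split; lra.
  have F0 : F !=set0.
    have [|U FU _] := stU ((s + t) / 2); first by apply/andP; split; lra.
    by exists U.
  have [|||V FV abV] := @compact_chain F `[s + n, t - n] F0 Ftot.
  - by move=> U /FP[].
  - exact: segment_compact.
  - by move=> w /=; rewrite in_itv /= => /andP[? ?]; apply: stU; apply/andP; split; lra.
  have [Vop _ Vloop] := FP _ FV.
  have Vcl : closed (~` V) by exact: open_closedC.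
  have Vs : ~ V s by move=> Vs; apply: Us; exists V.
  have Vt : ~ V t by move=> Vt; apply: Ut; exists V.
  have [||s1 [Vs1 /andP[ss1 s1n] s1P]] := @last_in_closed _ s (s + n) Vcl; [by []|lra|].
  have [||t1 [Vt1 /andP[tt1 t1n] t1P]] := @first_in_closed _ (t - n) t Vcl; [by []|lra|].
  have /Vloop-/(_ Vs1 Vt1) st1 : s1 < t1 by lra.
  apply: (@mdist_lt_split _ (f s1)); first by apply: dP; rewrite ltr_norml; apply/andP; split; lra.
  rewrite st1; first by apply: dP; rewrite ltr_norml; apply/andP; split; lra.
  move=> w /andP[s1w wt1]; have [wsn|wsn] := leP w (s + n).
    by apply: contrapT; apply: s1P; apply/andP; split.
  have [wtn|wtn] := leP (t - n) w.
    by apply: contrapT; apply: t1P; apply/andP; split.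
  by apply: abV; rewrite /= in_itv /=; apply/andP; split; lra.
pose C := ~` M.
have Ccl : closed C by exact: open_closedC.
have Cle0 t : t <= 0 -> C t by move=> t0 /M01 /=; rewrite ltNge t0.
have C1 : C 1 by move=> /M01 /=; rewrite ltxx andbF.
(* Adding the interval between [s] and [t] to [M] keeps it removable: a gap of the larger set either
   is one of [M] or is exactly this interval. Maximality then puts the interval inside [M]. *)
have gap s t : 0 <= s -> s < t -> t <= 1 -> C s -> C t -> f s = f t ->
    forall w, s < w < t -> M w.
  move=> s0 st t1 Cs Ct fst w wst; apply: contrapT => Mw.
  apply: (Mmax (M `|` [set w | s < w < t])).
    split=> [r Mr|]; first by left.
    by move=> /(_ w); apply: contra_not Mw => h; apply: h; right.
  split.
  - apply: openU => //.
    have -> : [set w | s < w < t] = [set` `]s, t[] by apply/seteqP; split=> r; rewrite /= in_itv.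
    exact: itv_open.
  - by move=> r [/M01//|/andP[sr rt]] /=; apply/andP; split; lra.
  move=> u v uv Bu Bv uvB.
  have Mu : C u by move=> Mu; apply: Bu; left.
  have Mv : C v by move=> Mv; apply: Bv; left.
  have [sv|sv] := ltP s v; last first.
    apply: Mloop => // r /andP[ur rv].
    by case: (uvB r) => [|//|/andP[? ?]]; [apply/andP; split|lra].
  have [ut|ut] := ltP u t; last first.
    apply: Mloop => // r /andP[ur rv].
    by case: (uvB r) => [|//|/andP[? ?]]; [apply/andP; split|lra].
  have us : u <= s by rewrite leNgt; apply/negP => su; apply: Bu; right; apply/andP; split.
  have tv : t <= v by rewrite leNgt; apply/negP => vt; apply: Bv; right; apply/andP; split.
  have -> : u = s.
    apply/eqP; rewrite eq_le us /= leNgt; apply/negP => us'.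
    by case: (uvB s) => [|//|/andP[? ?]]; [apply/andP; split; lra|lra].
  have -> // : v = t.
  apply/eqP; rewrite eq_le tv andbT leNgt; apply/negP => tv'.
  by case: (uvB t) => [|//|/andP[? ?]]; [apply/andP; split; lra|lra].
(* [l t] is the last parameter up to [t] outside [M], so [f \o l] keeps the value at the left end of
   a gap throughout that gap. *)
have /choice[l lP] : forall t, exists s,
    [/\ C s, s <= t, 0 <= t -> 0 <= s & forall w, s < w <= t -> M w].
  move=> t; have [t0|t0] := leP t 0.
    by exists t; split=> [|//|//|w]; [exact: Cle0|lra].
  have [||s [Cs /andP[s0 st] sP]] := @last_in_closed C 0 t Ccl; [exact: Cle0|lra|].
  by exists s; split=> // w /sP /contrapT.
have leq t w : C w -> w <= t -> w <= l t.
  move=> Cw wt; rewrite leNgt; apply/negP => lw.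
  by apply: Cw; have [_ _ _] := lP t; apply; apply/andP; split.
have lmono s t : s <= t -> l s <= l t.
  by move=> st; apply: leq; [case: (lP s)|have [_ ? _ _] := lP s; lra].
exists (f \o l); split.
- move=> e e0; have [d d0 dP] := fc _ e0; exists d => // s t.
  wlog st : s t / s <= t.
    move=> H; have [/H//|/ltW/H h] := leP s t.
    by rewrite distrC => /h; rewrite metric_sym.
  rewrite ltr_norml => /andP[std _] /=.
  have [Cs ls _ sM] := lP s; have [Ct lt _ tM] := lP t.
  have [lts|slt] := leP (l t) s.
    have -> : l s = l t by apply/eqP; rewrite eq_le lmono //=; exact: leq.
    by rewrite mdistxx.
  (* [l s] may be far from [s], but the gap that starts there ends at [r] with the same value, and
     [r] lies between [s] and [l t]. *)
  have [||r [Cr /andP[sr rt] rP]] := @first_in_closed C s (l t) Ccl; [by []|lra|].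
  have -> : f (l s) = f r.
    have : l s <= r by lra.
    rewrite le_eqVlt => /predU1P[->//|lsr].
    apply: Mloop => // w /andP[lsw wr]; have [ws|ws] := leP w s.
      by apply: sM; apply/andP; split.
    by apply: contrapT; apply: rP; apply/andP; split; lra.
  by apply: dP; rewrite ltr_norml; apply/andP; split; lra.
- have [_ l0 l0' _] := lP 0; congr f; apply/eqP; rewrite eq_le l0 /=; exact: l0'.
- have [_ l1 _ _] := lP 1; congr f; apply/eqP; rewrite eq_le l1 /=; exact: leq.
- by move=> t; exact: fA.
- move=> s u t /andP[s0 su] /andP[ut t1] /= fst.
  have [Cs ls ls0 _] := lP s; have [Ct lt _ _] := lP t; have [Cu _ _ _] := lP u.
  have := lmono _ _ su; have := lmono _ _ ut.
  rewrite le_eqVlt => /predU1P[->//|lut]; rewrite le_eqVlt => /predU1P[->//|lsu].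
  by case: (Cu); apply: (gap (l s) (l t)) => //; [exact: ls0|lra|lra|apply/andP; split].
Qed.

End paths.

(** * Reparametrization by a Whitney map *)

Section reparam.
Context {R : realType} {X : metricType R}.
Implicit Types (f g : R -> X) (A B : set X) (a b c : X) (r s t u v : R).

Lemma mdist_lipschitz a b c : `|mdist a b - mdist a c| <= mdist b c.
Proof.
have := metric_triangle a b c; have := metric_triangle a c b.
by rewrite (metric_sym c b) ler_norml => ? ?; apply/andP; split; lra.
Qed.

Definition dense_seq (k : nat) : R :=
  if choice.unpickle k is Some q then ratr (q : rat) else 0.

Lemma dense_seq_itv u v : u < v -> exists k, u < dense_seq k < v.
Proof.
move=> /rat_in_itvoo[q]; rewrite in_itv /= => uqv.
by exists (choice.pickle q); rewrite /dense_seq choice.pickleK.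
Qed.

Lemma sum_half_le (n : nat) (h : nat -> R) : (forall k, h k <= 1) ->
  \sum_(k < n) (2^-1) ^+ k.+1 * h k <= 1 - (2^-1) ^+ n.
Proof.
move=> h1; elim: n => [|n IH]; first by rewrite big_ord0 expr0 subrr.
rewrite big_ord_recr /=; apply: le_trans (lerD IH _) _.
  by apply: ler_piMr (h1 n); rewrite exprn_ge0.
by rewrite exprS; set z := _ ^+ n; lra.
Qed.

Variable f : R -> X.
Hypothesis f_uc : ucont f.
Hypothesis f_neg : forall t, t <= 0 -> f t = f 0.
Hypothesis f_mono : forall s u t, 0 <= s <= u -> u <= t <= 1 -> f s = f t -> f u = f s.

(** The distance, capped at 1, from the [k]-th point of a dense sequence of the path to the part of
    the path run through up to [t]. The cap bounds the weighted sums below. *)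
Definition gauge k t : R :=
  inf [set Num.min 1 (mdist (f (dense_seq k)) (f s)) | s in [set s | s <= t]].

Lemma gauge_le k s t : s <= t -> gauge k t <= Num.min 1 (mdist (f (dense_seq k)) (f s)).
Proof.
move=> st; apply: ge_inf; last by exists s.
by exists 0 => _ [u _ <-]; rewrite le_min ler01 mdist_ge0.
Qed.

Lemma gauge_ge k t (c : R) :
  (forall s, s <= t -> c <= Num.min 1 (mdist (f (dense_seq k)) (f s))) -> c <= gauge k t.
Proof.
move=> cP; apply: lb_le_inf; first by exists (Num.min 1 (mdist (f (dense_seq k)) (f t))), t => /=.
by move=> _ [u /= ut <-]; exact: cP.
Qed.

Lemma gauge_ge0 k t : 0 <= gauge k t.
Proof. by apply: gauge_ge => s _; rewrite le_min ler01 mdist_ge0. Qed.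

Lemma gauge_le1 k t : gauge k t <= 1.
Proof. by apply: le_trans (gauge_le k (lexx t)) _; rewrite ge_min lexx. Qed.

Lemma gauge_mono k s t : s <= t -> gauge k t <= gauge k s.
Proof. by move=> st; apply: gauge_ge => u us; apply: gauge_le; exact: le_trans st. Qed.

Lemma gauge_ucont e : 0 < e -> exists2 d, 0 < d &
  forall k s t, s <= t -> t - s < d -> gauge k s <= gauge k t + e.
Proof.
move=> e0; have [d d0 dP] := f_uc e0; exists d => // k s t st std.
rewrite -lerBlDr; apply: gauge_ge => u ut; rewrite lerBlDr.
have [us|su] := leP u s.
  by apply: le_trans (gauge_le k us) _; rewrite lerDl ltW.
apply: le_trans (gauge_le k (lexx s)) _.
have /dP dus : `|u - s| < d by rewrite ltr_norml; apply/andP; split; lra.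
have := metric_triangle (f (dense_seq k)) (f u) (f s).
by case: (leP 1 (mdist _ (f s))) => ?; case: (leP 1 (mdist _ (f u))) => ? ?; lra.
Qed.

Definition partial_gauge t n : R := \sum_(k < n) (2^-1) ^+ k.+1 * gauge k t.

(* A decreasing function of the compact set [f @` ]-oo, t]] (a Whitney map). *)
Definition whitney t : R := sup (range (partial_gauge t)).

Lemma partial_gauge_le t n : partial_gauge t n <= whitney t.
Proof.
apply: ub_le_sup; last by exists n.
exists 1 => _ [k _ <-]; apply: le_trans (sum_half_le _ (fun k => gauge_le1 k t)) _.
by rewrite gerBl exprn_ge0.
Qed.

Lemma whitney_le t (c : R) : (forall n, partial_gauge t n <= c) -> whitney t <= c.
Proof.
by move=> cP; apply: sup_le_ub; [exists (partial_gauge t 0), 0%N|move=> _ [n _ <-]].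
Qed.

Lemma partial_gauge_mono t n p : (n <= p)%N -> partial_gauge t n <= partial_gauge t p.
Proof.
move=> /subnKC<-; elim: (p - n)%N => [|q IH]; first by rewrite addn0.
rewrite addnS /partial_gauge big_ord_recr /=; apply: le_trans IH _.
by rewrite lerDl mulr_ge0 ?exprn_ge0 ?gauge_ge0.
Qed.

Lemma whitney_mono s t : s <= t -> whitney t <= whitney s.
Proof.
move=> st; apply: whitney_le => n; apply: le_trans (partial_gauge_le s n).
by apply: ler_sum => k _; apply: ler_wpM2l; [rewrite exprn_ge0|exact: gauge_mono].
Qed.

Lemma whitney_continuous : continuous whitney.
Proof.
move=> t; apply/cvgrPdist_le => e e0; have [d d0 dP] := gauge_ucont e0.
have key u v : u <= v -> v - u < d -> `|whitney u - whitney v| <= e.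
  move=> uv uvd; rewrite ger0_norm ?subr_ge0 ?whitney_mono// lerBlDr.
  apply: whitney_le => n; rewrite addrC; apply: le_trans (lerD (partial_gauge_le v n) (lexx e)).
  apply: (@le_trans _ _ (partial_gauge v n + \sum_(k < n) (2^-1) ^+ k.+1 * e)).
    rewrite /partial_gauge -big_split /=; apply: ler_sum => k _.
    by rewrite -mulrDr; apply: ler_wpM2l; [rewrite exprn_ge0|exact: dP].
  rewrite lerD2l -mulr_suml; apply: ler_piMl; first exact: ltW.
  have := @sum_half_le n (fun=> 1) (fun=> lexx 1).
  under eq_bigr do rewrite mulr1.
  by move=> /le_trans; apply; rewrite gerBl exprn_ge0.
apply/nbhs_normP; exists d => //= s /=; rewrite ltr_norml => /andP[? ?].
have [ts|/ltW st] := leP t s; first by apply: key => //; lra.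
by rewrite distrC; apply: key => //; lra.
Qed.

(** By [f_mono] the value [f t] is not attained up to [s], so it has a positive distance [r] to that
    part of the path. For a rational parameter close to [t], the gauge is below [r / 2] at [t] but
    not at [s], while no other gauge increases. *)
Lemma whitney_strict s t : 0 <= s -> s < t -> t <= 1 -> f s <> f t -> whitney t < whitney s.
Proof.
move=> s0 st t1 fst.
have [r r0 rP] : exists2 r, 0 < r & forall u, u <= s -> r <= Num.min 1 (mdist (f t) (f u)).
  have [|||c /set_mem /= cs cP] := @compact_EVT_min R R (fun u => mdist (f t) (f u)) `[0, s].
  - by exists 0; rewrite /= in_itv /= lexx.
  - exact: segment_compact.
  - apply: continuous_subspaceT => u; apply/cvgrPdist_lt => e /f_uc[d d0 dP].
    apply/nbhs_normP; exists d => //= v uv.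
    by apply: le_lt_trans (mdist_lipschitz _ _ _) _; exact: dP.
  move: cs; rewrite in_itv /= => /andP[c0 cs].
  exists (Num.min 1 (mdist (f t) (f c))).
    rewrite lt_min ltr01 mdist_gt0; apply/eqP => ftc; apply: fst.
    by rewrite ftc; apply: (@f_mono c s t); [rewrite c0 cs|rewrite (ltW st) t1|].
  move=> u us; rewrite le_min ge_min lexx /= ge_min; apply/orP; right.
  have [u0|u0] := leP u 0.
    by rewrite (f_neg u0); apply: cP; rewrite inE /= in_itv /= lexx.
  by apply: cP; rewrite inE /= in_itv /= us ltW.
have r1 : r <= 1 by have := rP s (lexx s); rewrite le_min => /andP[].
have r20 : 0 < r / 2 by lra.
have [d d0 dP] := f_uc r20.
have [|k /andP[k1 k2]] := @dense_seq_itv (t - d) (t + d); first by lra.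
have dq : mdist (f (dense_seq k)) (f t) < r / 2.
  by apply: dP; rewrite ltr_norml; apply/andP; split; lra.
have gt : gauge k t < r / 2.
  by apply: le_lt_trans (gauge_le k (lexx t)) _; rewrite gt_min dq orbT.
have gs : r / 2 <= gauge k s.
  apply: gauge_ge => u /rP; rewrite !le_min => /andP[_ rtu].
  have := metric_triangle (f t) (f (dense_seq k)) (f u).
  by rewrite (metric_sym (f t) (f (dense_seq k))) => ?; apply/andP; split; lra.
pose n := (2^-1 : R) ^+ k.+1 * (gauge k s - gauge k t).
have n0 : 0 < n by rewrite mulr_gt0 ?exprn_gt0 ?subr_gt0// (lt_le_trans gt).
suff : whitney t <= whitney s - n by lra.
apply: whitney_le => p; rewrite lerBrDr.
apply: le_trans (partial_gauge_le s (p + k.+1)).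
apply: (@le_trans _ _ (partial_gauge t (p + k.+1) + n)).
  by rewrite lerD2r partial_gauge_mono ?leq_addr.
rewrite /partial_gauge -lerBrDl -sumrB.
under eq_bigr do rewrite -mulrBr.
have kp : (k < p + k.+1)%N by rewrite addnS ltnS leq_addl.
rewrite (bigD1 (Ordinal kp)) //= lerDl; apply: sumr_ge0 => i _.
by rewrite mulr_ge0 ?exprn_ge0 ?subr_ge0 ?gauge_mono ?ltW.
Qed.

Lemma whitney_inj s t : 0 <= s <= 1 -> 0 <= t <= 1 ->
  (whitney s = whitney t) <-> (f s = f t).
Proof.
wlog st : s t / s < t.
  move=> H s01 t01; have [st|ts|->//] := ltgtP s t; first exact: H.
  by have := H _ _ ts t01 s01; split=> /esym /H ->.
move=> /andP[s0 s1] /andP[t0 t1]; split=> [wst|fst].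
  by apply: contrapT => /(whitney_strict s0 st t1); rewrite wst ltxx.
have <- // : whitney t = whitney s; rewrite /whitney.
have -> // : partial_gauge t = partial_gauge s.
apply/funext => n; apply: eq_bigr => k _; congr (_ * _); symmetry.
congr inf; apply/seteqP; split=> _ [u /= ut <-].
  by exists u => //=; exact: le_trans (ltW st).
have [us|su] := leP u s; first by exists u.
by exists s => //=; rewrite (@f_mono s u t)//; [rewrite s0 ltW|rewrite ut].
Qed.

Lemma mdist_path_continuous : continuous (fun p : R * R => mdist (f p.1) (f p.2)).
Proof.
move=> p; apply/cvgrPdist_lt => e e0; have e20 : 0 < e / 2 by lra.
have [d d0 dP] := f_uc e20; near=> q.
have q1 : mdist (f p.1) (f q.1) < e / 2.
  by apply: dP; near: q; apply: cvgr_dist_lt d0; exact: cvg_fst.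
have q2 : mdist (f p.2) (f q.2) < e / 2.
  by apply: dP; near: q; apply: cvgr_dist_lt d0; exact: cvg_snd.
have := mdist_lipschitz (f p.1) (f p.2) (f q.2).
have := mdist_lipschitz (f q.2) (f p.1) (f q.1).
rewrite !(metric_sym (f q.2)) !ler_norml ltr_norml => /andP[? ?] /andP[? ?].
by apply/andP; split; lra.
Unshelve. all: by end_near. Qed.

(** The pairs of parameters whose values are at least [e] apart form a compact set on which the
    difference of the [whitney] values does not vanish; its minimal absolute value is the required
    [d]. *)
Lemma whitney_inverse_ucont e : 0 < e -> exists2 d, 0 < d & forall s t,
  0 <= s <= 1 -> 0 <= t <= 1 -> `|whitney s - whitney t| < d -> mdist (f s) (f t) < e.
Proof.
move=> e0; pose E := (`[0, 1] `*` `[0, 1] : set (R * R)) `&`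
  [set p | e <= mdist (f p.1) (f p.2)].
have Eco : compact E.
  apply: compact_closedI; first by apply: compact_setX; exact: segment_compact.
  apply: (preimage_closed (f := fun p : R * R => mdist (f p.1) (f p.2))) (@closed_ge _ e).
  by move=> p _; exact: mdist_path_continuous.
have [/eqP E0|/set0P E0] := boolP (E == set0).
  exists 1 => // s t s01 t01 _; rewrite ltNge; apply/negP => est.
  by have : E (s, t) by []; rewrite E0.
have [|p /set_mem[[p1 p2] pe] pP] := @compact_EVT_min _ R
  (fun p : R * R => `|whitney p.1 - whitney p.2|) E E0 Eco.
  apply: continuous_subspaceT => p; apply: cvg_norm; apply: cvgB.
    by apply: continuous_comp; [exact: cvg_fst|exact: whitney_continuous].
  by apply: continuous_comp; [exact: cvg_snd|exact: whitney_continuous].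
exists `|whitney p.1 - whitney p.2|.
  rewrite normr_gt0 subr_eq0; apply/eqP => /whitney_inj-/(_ p1 p2) fp.
  by move: pe; rewrite /= fp mdistxx leNgt e0.
move=> s t s01 t01; rewrite ltNge; apply: contraNlt => est.
by apply: (pP (s, t)); rewrite inE.
Qed.

(** The value of [whitney], rescaled affinely by [v], becomes the parameter. The choice [k] of
    preimages may be discontinuous, but [f \o k] is not, because [f] depends uniformly continuously
    on [whitney]. *)
Lemma reparametrize A : (forall t, A (f t)) -> f 0 <> f 1 -> arc_in A (f 0) (f 1).
Proof.
move=> fA f01; pose v t := whitney 0 - t * (whitney 0 - whitney 1).
have w01 : whitney 1 < whitney 0 by exact: whitney_strict.
have /choice[k kP] : forall t, exists s, 0 <= t <= 1 -> 0 <= s <= 1 /\ whitney s = v t.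
  move=> t; have [/andP[t0 t1]|] := boolP (0 <= t <= 1); last by exists 0.
  have [|||s] := @IVT R whitney 0 1 (v t) => //.
  - exact/continuous_subspaceT/whitney_continuous.
  - rewrite min_r ?max_l ?(ltW w01)// /v; apply/andP; split; nra.
  by rewrite in_itv /= => ? ?; exists s.
have [e e0|g [guc gA gk _]] := @clamp_path _ _ (f \o k) A _ (fun t _ => fA _).
  have [d d0 dP] := whitney_inverse_ucont e0.
  pose c := whitney 0 - whitney 1; have c0 : 0 < c by rewrite subr_gt0.
  exists (d / c); first exact: divr_gt0.
  move=> s t s01 t01; rewrite ltr_pdivlMr// => std; apply: dP; [by case: (kP s)..|by case: (kP t)|].
  have [_ ->] := kP _ s01; have [_ ->] := kP _ t01.
  have -> : v s - v t = (t - s) * c by rewrite /v -/c; lra.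
  by rewrite normrM distrC (gtr0_norm c0).
have gkE t : 0 <= t <= 1 -> whitney (k t) = v t by move=> /kP[].
have g0 : g 0 = f 0.
  rewrite gk ?lexx ?ler01//= -whitney_inj ?lexx ?ler01//.
    by rewrite gkE ?lexx ?ler01// /v; lra.
  by case: (kP 0); rewrite ?lexx ?ler01.
have g1 : g 1 = f 1.
  rewrite gk ?lexx ?ler01//= -whitney_inj ?lexx ?ler01//.
    by rewrite gkE ?lexx ?ler01// /v; lra.
  by case: (kP 1); rewrite ?lexx ?ler01.
exists g; split => // s t s01 t01; rewrite !gk//= => /whitney_inj.
have [ks ->] := kP _ s01; have [kt ->] := kP _ t01.
move=> /(_ ks kt); rewrite /v => vst; apply: contrapT => st.
have : (s - t) * (whitney 0 - whitney 1) = 0 by lra.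
by move=> /eqP; rewrite mulf_eq0 !subr_eq0 (gt_eqF w01) orbF => /eqP.
Qed.

End reparam.

(** * Arcs and closed curves *)

Section arcs.
Context {R : realType} {X : metricType R}.
Implicit Types (f g : R -> X) (A B : set X) (a b c : X) (r s t u v : R).

Lemma path_arc A a b : path_in A a b -> a <> b -> arc_in A a b.
Proof.
move=> [f [fuc <- <- fA]] fab.
have [g [guc g0 g1 gA gmono]] := loop_erasure fuc fA.
have [|h [huc hA hE hneg]] := @clamp_path _ _ g A _ (fun t _ => gA t).
  by move=> e /guc[d d0 dP]; exists d => // s t _ _; exact: dP.
have h0 : h 0 = f 0 by rewrite hE ?lexx ?ler01.
have h1 : h 1 = f 1 by rewrite hE ?lexx ?ler01.
rewrite -h0 -h1; apply: reparametrize => //; last by rewrite h0 h1.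
- by move=> t t0; rewrite hneg// h0.
- move=> s u t /andP[s0 su] /andP[ut t1]; rewrite !hE; [|apply/andP; split; lra..].
  by apply: gmono; apply/andP; split.
Qed.

Lemma path_sub A B a b : A `<=` B -> path_in A a b -> path_in B a b.
Proof. by move=> AB [f [fuc fa fb fA]]; exists f; split=> // t; exact: AB. Qed.

Definition glue f g t := if t <= 2^-1 then f (2 * t) else g (2 * t - 1).

Lemma glue_ucont f g : f 1 = g 0 -> ucont f -> ucont g -> ucont (glue f g).
Proof.
move=> fg fuc guc e e0; have e20 : 0 < e / 2 by lra.
have [d d0 dP] := fuc _ e20; have [d' d'0 d'P] := guc _ e20.
exists (Num.min d d' / 2); first by rewrite divr_gt0// lt_min d0.
move=> s t; rewrite ltr_pdivlMr// lt_min.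
wlog st : s t / s <= t.
  move=> H; have [/H//|/ltW/H h] := leP s t.
  by rewrite distrC => /h; rewrite metric_sym.
rewrite distrC ger0_norm ?subr_ge0// => /andP[std std'].
rewrite /glue; have [s2|s2] := leP s (2^-1); have [t2|t2] := leP t (2^-1).
- apply: lt_trans (_ : e / 2 < e); last by lra.
  by apply: dP; rewrite ltr_norml; apply/andP; split; lra.
- apply: (@mdist_lt_split _ _ _ (f 1)).
    by apply: dP; rewrite ltr_norml; apply/andP; split; lra.
  by rewrite fg; apply: d'P; rewrite ltr_norml; apply/andP; split; lra.
- by move: (le_lt_trans t2 (lt_le_trans s2 st)); rewrite ltxx.
- apply: lt_trans (_ : e / 2 < e); last by lra.
  by apply: d'P; rewrite ltr_norml; apply/andP; split; lra.
Qed.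

Lemma glue0 f g : glue f g 0 = f 0.
Proof. by rewrite /glue mulr0 invr_ge0 ler0n. Qed.

Lemma glue1 f g : glue f g 1 = g 1.
Proof.
rewrite /glue leNgt invf_lt1 ?ltr0n// ltr1n /=.
by congr g; lra.
Qed.

Lemma path_in_trans A b a c : path_in A a b -> path_in A b c -> path_in A a c.
Proof.
move=> [f [fuc <- fb fA]] [g [guc gb <- gA]]; exists (glue f g); split.
- by apply: glue_ucont => //; rewrite fb gb.
- exact: glue0.
- exact: glue1.
- by move=> t; rewrite /glue; case: ifP.
Qed.

Lemma path_image A a b (F : X -> X) : (forall x y, mdist (F x) (F y) <= mdist x y) ->
  path_in A a b -> path_in (F @` A) (F a) (F b).
Proof.
move=> Fl [f [fuc <- <- fA]]; exists (F \o f); split=> // [e|t]; last by exists (f t).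
by move=> /fuc[d d0 dP]; exists d => // s t /dP; apply: le_lt_trans (Fl _ _).
Qed.

Definition path_connected A := forall a b, A a -> A b -> path_in A a b.

(* Follow an arc of [A] from [a] until its first return to [B], which exists because
   [A `&` B] is finite, and come back to [a] inside [B]. *)
Lemma path_connected_closed_curve A B a b : path_connected A -> path_connected B ->
  finite_set (A `&` B) -> (A `&` B) a -> (A `&` B) b -> a <> b ->
  exists2 L, simple_closed_curve L & L `<=` A `|` B.
Proof.
move=> Apc Bpc ABfin [Aa Ba] [Ab Bb] ab.
have [f [fuc f0 f1 fA finj]] := path_arc (Apc _ _ Aa Ab) ab.
pose T := [set t | 0 < t <= 1 /\ B (f t)].
have Tfin : finite_set T.
  pose g x := xget 0 [set t | 0 <= t <= 1 /\ f t = x].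
  apply: sub_finite_set (finite_image g ABfin) => t [/andP[t0 t1] Bt].
  exists (f t); first by split.
  have [|g01 /finj] := @xgetPex _ 0 [set s | 0 <= s <= 1 /\ f s = f t].
    by exists t; rewrite /= (ltW t0) t1.
  by apply=> //; rewrite (ltW t0) t1.
have Tcl : closed T.
  exact: (accessible_finite_set_closed.1 (hausdorff_accessible (@Rhausdorff R))).
have [||v [[/andP[v0 v1] Bv] _ vP]] := @first_in_closed _ _ 0 1 Tcl.
- by split; [rewrite ltr01 lexx|rewrite f1].
- exact: ler01.
have va : f v <> a.
  rewrite -f0 => /finj; rewrite (ltW v0) v1 lexx ler01 => /(_ isT isT) v00.
  by move: v0; rewrite v00 ltxx.
have [g [guc g0 g1 gB ginj]] := path_arc (Bpc _ _ Bv Ba) va.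
pose h := glue (fun t => f (v * t)) g.
have huc : ucont h.
  apply: glue_ucont => //; first by rewrite mulr1 g0.
  move=> e /fuc[d d0 dP]; exists d => // s t st; apply: dP.
  by rewrite -mulrBr normrM (gtr0_norm v0); apply: le_lt_trans st; rewrite ler_piMl.
exists (h @` `[0, 1]); last first.
  by move=> _ [t _ <-]; rewrite /h /glue; case: ifP => _; [left|right].
exists h; split => //.
- exact/continuous_subspaceT/ucont_continuous.
- by rewrite /h glue0 glue1 mulr0 g1.
move=> s t; rewrite !in_itv /= => s01 t01.
wlog st : s t s01 t01 / s <= t.
  by move=> H; have [/H|/ltW/H h'] := leP s t; [exact|move=> /esym /h' ->].
move: s01 t01 => /andP[s0 s1] /andP[t0 t1].
rewrite /h /glue; have [s2|s2] := leP s (2^-1); have [t2|t2] := leP t (2^-1).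
- move=> /finj H; have : v * (2 * s) = v * (2 * t) by apply: H; apply/andP; split; nra.
  by move=> /(mulfI (lt0r_neq0 v0)); lra.
(* By the choice of [v], the first half of the curve meets [B] only at its ends. The end [s = 0]
   would force [t = 1], and the end [2 * s = 1] would force [2 * t = 1]. *)
- move=> fgst; have Bf : B (f (v * (2 * s))) by rewrite fgst.
  have gh : 0 <= 2 * t - 1 <= 1 by apply/andP; split; lra.
  have [s20|s20] := eqVneq s 0.
    suff : 2 * t - 1 = 1 by lra.
    by apply: ginj => //; rewrite ?lexx ?ler01// g1 -fgst s20 !mulr0.
  have sgt0 : 0 < s by rewrite lt_def s20.
  have [sh|sh] := ltP (2 * s) 1.
    by case: (vP (v * (2 * s))); [apply/andP; split; nra|split=> //; apply/andP; split; nra].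
  suff : 2 * t - 1 = 0 by lra.
  apply: ginj => //; first by rewrite lexx ler01.
  by rewrite -fgst g0; congr f; nra.
- by move: (le_lt_trans t2 (lt_le_trans s2 st)); rewrite ltxx.
- by move=> /ginj H; have : 2 * s - 1 = 2 * t - 1 by [apply: H; apply/andP; split; lra]; lra.
Qed.

End arcs.

(** * Pieces of an attractor *)

Section iterated_system.
Context {R : realType} {X : metricType R} {m : nat}.
Variables (S : 'I_m -> X -> X) (K : set X).
Implicit Types (i l : 'I_m) (j : seq 'I_m) (a : nat -> 'I_m) (x y z p b : X).
Hypothesis S_inj : forall i, injective (S i).
Hypothesis S_contr : forall i, contractive (S i).
Hypothesis K_attr : attractor S K.

Let K0 : K !=set0. Proof. by case: K_attr. Qed.
Let Kco : compact K. Proof. by case: K_attr. Qed.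
Let KE : K = \bigcup_i (S i @` K). Proof. by case: K_attr. Qed.

Lemma uniform_contraction : exists q : R, 0 <= q < 1 /\
  forall i x y, mdist (S i x) (S i y) <= q * mdist x y.
Proof.
have /choice[q qP] := S_contr.
exists (\big[Num.max/0]_i q i); split.
  apply/andP; split; first exact: bigmax_ge_id.
  by apply: bigmax_lt => [|i _]; [exact: ltr01|case: (qP i) => /andP[]].
move=> i x y; have [_ /(_ x y) /le_trans] := qP i; apply.
by rewrite ler_wpM2r ?mdist_ge0 ?le_bigmax.
Qed.

Lemma S_lipschitz i x y : mdist (S i x) (S i y) <= mdist x y.
Proof.
have [q [/andP[_ q1] qP]] := uniform_contraction.
by apply: le_trans (qP i x y) _; rewrite ler_piMl ?mdist_ge0 ?ltW.
Qed.

Lemma label_S i x : label S i (S i x) = x.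
Proof. by apply: (@S_inj i); exact: (@xgetI _ _ (S i @^-1` [set S i x]) x). Qed.

Lemma S_in_K i x : K x -> K (S i x).
Proof. by move=> Kx; rewrite KE; exists i => //; exists x. Qed.

Lemma K_cover x : K x -> exists i, piece S K [:: i] x.
Proof. by rewrite {1}KE => -[i _ ix]; exists i. Qed.

Lemma S_word_cat j k x : S_word S (j ++ k) x = S_word S j (S_word S k x).
Proof. by rewrite /S_word foldr_cat. Qed.

Lemma S_word_inj j : injective (S_word S j).
Proof. by elim: j => [|i j IH] x y //= /S_inj /IH. Qed.

Lemma S_word_lipschitz j x y : mdist (S_word S j x) (S_word S j y) <= mdist x y.
Proof. by elim: j => [|i j IH] //=; apply: le_trans (S_lipschitz _ _ _) IH. Qed.

Lemma lipschitz_continuous (F : X -> X) :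
  (forall x y, mdist (F x) (F y) <= mdist x y) -> continuous F.
Proof.
move=> Fl x; apply/metricType_numDomainType.cvgrPdist_lt => e e0.
near=> y; apply: le_lt_trans (Fl _ _) _.
near: y; exact: (metricType_numDomainType.cvgr_dist_lt (f := id)).
Unshelve. all: by end_near. Qed.

Lemma S_word_continuous j : continuous (S_word S j).
Proof. exact/lipschitz_continuous/S_word_lipschitz. Qed.

Lemma image_cat j k (A : set X) :
  S_word S (j ++ k) @` A = S_word S j @` (S_word S k @` A).
Proof.
apply/seteqP; split=> [_ [x Ax <-]|_ [_ [x Ax <-] <-]].
  by rewrite S_word_cat; exists (S_word S k x) => //; exists x.
by exists x => //; rewrite S_word_cat.
Qed.

Lemma piece_sub_K j : piece S K j `<=` K.
Proof.
move=> _ [x Kx <-]; elim: j => [//|i j IH] /=; exact: S_in_K.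
Qed.

Lemma piece_cat j k : piece S K (j ++ k) `<=` piece S K j.
Proof.
by rewrite /piece image_cat => _ [y /piece_sub_K Ky <-]; exists y.
Qed.

Lemma piece_split j x : piece S K j x -> exists i, piece S K (rcons j i) x.
Proof.
move=> [y /K_cover[i [z Kz <-]] <-]; exists i; rewrite -cats1.
by exists z => //; rewrite S_word_cat.
Qed.

Lemma piece_compact j : compact (piece S K j).
Proof.
by apply: continuous_compact => //; apply: continuous_subspaceT; exact: S_word_continuous.
Qed.

Lemma piece_closed j : closed (piece S K j).
Proof. by apply: compact_closed; [exact: metric_hausdorff|exact: piece_compact]. Qed.

Lemma piece_nonempty j : piece S K j !=set0.
Proof. by have [x Kx] := K0; exists (S_word S j x), x. Qed.

Lemma wordS a n : word a n.+1 = rcons (word a n) (a n).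
Proof. exact: mkseqS. Qed.

Lemma word_cons a n : word a n.+1 = a 0%N :: word (a \o succn) n.
Proof. by rewrite /word /mkseq /= (iotaDl 1 0) -map_comp. Qed.

Lemma size_word a n : size (word a n) = n.
Proof. exact: size_mkseq. Qed.

Lemma piece_word_mono a k n : (k <= n)%N -> piece S K (word a n) `<=` piece S K (word a k).
Proof.
move=> /subnKC<-; elim: (n - k)%N => [|p IH]; first by rewrite addn0.
by rewrite addnS wordS -cats1; apply: subset_trans IH; exact: piece_cat.
Qed.

Lemma piece_small e : 0 < e ->
  exists n, forall j x y, (n <= size j)%N -> piece S K j x -> piece S K j y -> mdist x y < e.
Proof.
move=> e0; have [q [/andP[q0 q1] qP]] := uniform_contraction.
have [x0 Kx0] := K0.
have [D D0 DP] : exists2 D, 0 <= D & forall x y, K x -> K y -> mdist x y <= D.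
  have [|c _ cP] := @compact_EVT_max X R (mdist x0) K K0 Kco.
    apply: continuous_subspaceT => x; apply/cvgrPdist_lt => d d0.
    near=> y; apply: le_lt_trans (mdist_lipschitz _ _ _) _.
    near: y; exact: (metricType_numDomainType.cvgr_dist_lt (f := id)).
  exists (mdist x0 c + mdist x0 c); first by rewrite addr_ge0 ?mdist_ge0.
  move=> x y Kx Ky; apply: le_trans (metric_triangle x x0 y) _.
  by rewrite (metric_sym x) lerD ?cP ?inE.
have [n nP] : exists n, q ^+ n * D < e.
  have e'0 : 0 < e / (D + 1) by rewrite divr_gt0// ltr_wpDl.
  have q1' : `|q| < 1 by rewrite ger0_norm.
  have /cvgrPdist_lt/(_ _ e'0)[n _ /(_ n (leqnn n))] := cvg_expr q1'.
  rewrite /= sub0r normrN normrX ger0_norm// ltr_pdivlMr ?ltr_wpDl// => qn.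
  by exists n; apply: le_lt_trans qn; rewrite ler_wpM2l ?exprn_ge0// lerDl.
exists n => j x y nj [x' Kx' <-] [y' Ky' <-]; apply: le_lt_trans nP.
apply: (@le_trans _ _ (q ^+ size j * D)); last first.
  by rewrite ler_wpM2r//; apply: ler_wiXn2l nj => //; exact: ltW.
elim: j {nj} => [|i j IH] /=; first by rewrite expr0 mul1r DP.
by apply: le_trans (qP _ _ _) _; rewrite exprS -mulrA ler_wpM2l.
Unshelve. all: by end_near. Qed.

End iterated_system.

(** * Paths in a connected attractor *)

Section connected_attractor.
Context {R : realType} {X : metricType R} {m : nat}.
Variables (S : 'I_m -> X -> X) (K : set X).
Implicit Types (i l : 'I_m) (j : seq 'I_m) (a : nat -> 'I_m) (x y z p b : X).
Hypothesis S_inj : forall i, injective (S i).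
Hypothesis S_contr : forall i, contractive (S i).
Hypothesis K_attr : attractor S K.
Hypothesis K_conn : connected K.

Let K0 : K !=set0. Proof. by case: K_attr. Qed.
Let Kco : compact K. Proof. by case: K_attr. Qed.
Let KE : K = \bigcup_i (S i @` K). Proof. by case: K_attr. Qed.

Lemma address_point a : exists x, forall n, piece S K (word a n) x.
Proof.
have [x0 Kx0] := K0; pose u n := S_word S (word a n) x0.
have uP k n : (k <= n)%N -> piece S K (word a k) (u n).
  by move=> /(piece_word_mono K_attr (a := a)); apply; exists x0.
have [|x [Kx xu]] := @Kco (u @ \oo) _.
  by exists 0%N => // n _; exact: (piece_sub_K K_attr) (uP 0%N n isT).
exists x => n.
rewrite (closure_id (piece S K (word a n))).1; last exact: piece_closed.
move=> B xB; apply: xu xB.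
by exists n => // k; exact: uP.
Qed.

Definition meets i l := `[< piece S K [:: i] `&` piece S K [:: l] !=set0 >].

Definition meets_in (J : pred 'I_m) i l := [&& J i, J l & meets i l].

Lemma meets_inC J i l : meets_in J i l = meets_in J l i.
Proof. by rewrite /meets_in /meets setIC andbCA. Qed.

Lemma connect_meets_inC J : connect_sym (meets_in J).
Proof. by apply: sym_connect_sym => i l; exact: meets_inC. Qed.

Definition cells (J : pred 'I_m) := \bigcup_(i in [set` J]) piece S K [:: i].

Lemma cells_closed J : closed (cells J).
Proof. by apply: closed_bigcup => // i _; exact: piece_closed. Qed.

(** Otherwise the cells linked to [i] and the remaining cells would split [K] into two disjoint
    closed sets. *)
Lemma meets_connected i l : connect (meets_in predT) i l.
Proof.
pose J := [pred k | connect (meets_in predT) i k].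
pose J' := [pred k | ~~ J k].
have KJ : K `<=` cells J `|` cells J'.
  move=> x /(K_cover K_attr)[k kx]; have [Jk|Jk] := boolP (J k); first by left; exists k.
  by right; exists k.
have disj x : cells J x -> cells J' x -> False.
  move=> [k Jk kx] [k' J'k' k'x]; have /negP := J'k'; apply => /=.
  apply: connect_trans Jk (connect1 _); rewrite /meets_in /=.
  by apply/asboolP; exists x.
have JK J0 : cells J0 `<=` K by move=> x [k _]; exact: piece_sub_K.
have KJE : K `&` cells J = K.
  apply: K_conn.
  - have [x ix] := piece_nonempty K_attr [:: i].
    by exists x; split; [exact: (piece_sub_K K_attr) ix|exists i => //=; exact: connect0].
  - exists (~` cells J'); first exact/closed_openC/cells_closed.
    apply/seteqP; split=> x [Kx]; first by move=> Jx; split=> // /(disj _ Jx).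
    by move=> J'x; split=> //; case: (KJ x Kx).
  - by exists (cells J) => //; exact: cells_closed.
apply: contrapT => /negP il; have [x lx] := piece_nonempty K_attr [:: l].
have : K x by exact: (piece_sub_K K_attr) lx.
by rewrite -KJE => -[_ /disj]; apply; exists l.
Qed.

Fixpoint chain n x y : Prop :=
  if n is n'.+1 then exists z i, [/\ piece S K [:: i] x, piece S K [:: i] z & chain n' z y]
  else x = y.

Lemma chain_widen n k x y : K x -> (n <= k)%N -> chain n x y -> chain k x y.
Proof.
move=> Kx /subnKC<-; elim: (k - n)%N => [|p IH]; first by rewrite addn0.
move=> /IH xy; rewrite addnS /=; have [i ix] := K_cover K_attr Kx.
by exists x, i.
Qed.

Lemma chain_path i (p : seq 'I_m) x y : path (meets_in predT) i p ->
  piece S K [:: i] x -> piece S K [:: last i p] y -> chain (size p).+1 x y.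
Proof.
elim: p i x => [|l p IH] i x /=; first by move=> _ ix iy; exists y, i.
move=> /andP[/asboolP[z [iz lz]] lp] ix ly; exists z, i; split=> //.
exact: IH ly.
Qed.

(** A simple walk visits each of the [m] cells at most once. Padding by [chain_widen] gives one
    length for all pairs of points, which then serves as the number base. *)
Lemma chain_K x y : K x -> K y -> chain m.+1 x y.
Proof.
move=> Kx Ky; have [i ix] := K_cover K_attr Kx; have [l ly] := K_cover K_attr Ky.
have /connectP[p ip lp] := meets_connected i l; move: ly; rewrite {}lp.
case/shortenP: ip => q iq uq _ ly; apply: (@chain_widen (size q).+1) => //.
  rewrite ltnS -ltnS -[(size q).+1]/(size (i :: q)) ltnW// ltnS -(card_uniqP uq).
  by rewrite -[leqRHS]card_ord max_card.
exact: chain_path iq ix ly.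
Qed.

Lemma chain_seq i0 n x y : chain n x y -> exists zi : (nat -> X) * (nat -> 'I_m),
  [/\ zi.1 0%N = x, zi.1 n = y & forall s, (s < n)%N ->
    piece S K [:: zi.2 s] (zi.1 s) /\ piece S K [:: zi.2 s] (zi.1 s.+1)].
Proof.
elim: n x => [|n IH] x /=; first by move=> <-; exists (fun=> x, fun=> i0).
move=> [z [i [ix iz /IH[[u k] /= [u0 un uP]]]]].
exists (fun s => if s is s'.+1 then u s' else x, fun s => if s is s'.+1 then k s' else i).
by split=> //= -[_|s /uP//]; rewrite u0.
Qed.

(* The parameter [t] of a state [(x, y, t)] is read in base [m.+1]: the piece
   containing the value at [t] of a path from [x] to [y] is the one of the link of a
   chain of [m.+1] cells from [x] to [y] which is selected by the first digit of [t]. *)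
Section states.
Variable zi : X * X -> (nat -> X) * (nat -> 'I_m).
Hypothesis ziP : forall x y, K x -> K y -> [/\ (zi (x, y)).1 0%N = x, (zi (x, y)).1 m.+1 = y &
  forall s, (s < m.+1)%N -> piece S K [:: (zi (x, y)).2 s] ((zi (x, y)).1 s) /\
     piece S K [:: (zi (x, y)).2 s] ((zi (x, y)).1 s.+1)].

Let N : R := m.+1%:R.

(** The cap at [m] is for [t = 1], all of whose digits are thus [m], so that the path ends at the
    last point of the chain. *)
Definition digit (t : R) : nat := minn (Num.truncn (N * t)) m.

Definition state_index (v : X * X * R) : 'I_m := (zi v.1).2 (digit v.2).

(** Zooms into the selected link: its ends, pulled back by the contraction of its cell, are the end
    points of the next state, and the parameter loses its first digit. *)
Definition step (v : X * X * R) : X * X * R :=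
  let s := digit v.2 in let i := (zi v.1).2 s in
  (label S i ((zi v.1).1 s), label S i ((zi v.1).1 s.+1), N * v.2 - s%:R).

Definition code v n := state_index (iter n step v).

Definition good_state (v : X * X * R) := [/\ K v.1.1, K v.1.2 & 0 <= v.2 <= 1].

Lemma label_piece i x : piece S K [:: i] x -> K (label S i x) /\ S i (label S i x) = x.
Proof. by move=> [y Ky <-]; rewrite /= label_S. Qed.

Lemma digitP t : 0 <= t <= 1 -> (digit t < m.+1)%N /\ 0 <= N * t - (digit t)%:R <= 1.
Proof.
move=> /andP[t0 t1]; have N0 : 0 < N by rewrite ltr0n.
have Nt0 : 0 <= N * t by rewrite mulr_ge0 ?ler0n.
rewrite /digit; split; first by rewrite ltnS geq_minr.
have /andP[] := truncn_itv Nt0; rewrite -natr1 => h1 h2.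
have [mt|tm] := leqP (Num.truncn (N * t)) m; first by apply/andP; split; lra.
have : (m.+1%:R : R) <= (Num.truncn (N * t))%:R by rewrite ler_nat.
rewrite -/N => h3; have : N * t <= N by rewrite ler_piMr ?ler0n.
have NE : N = m%:R + 1 by rewrite /N -natr1.
by move=> ?; apply/andP; split; lra.
Qed.

Lemma step_good v : good_state v -> good_state (step v).
Proof.
move: v => [[x y] t] [/= Kx Ky t01]; have [dm dt] := digitP t01.
have [_ _ /(_ _ dm)[/label_piece[? _] /label_piece[? _]]] := ziP Kx Ky.
by split.
Qed.

Lemma code_step v : code v \o succn = code (step v).
Proof. by apply/funext => n; rewrite /code /= -iterSr. Qed.

Lemma code_word v n : word (code v) n.+1 = state_index v :: word (code (step v)) n.
Proof. by rewrite word_cons code_step. Qed.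

Lemma pow_le1 n : N ^- n <= 1.
Proof. by rewrite invf_le1 ?exprn_gt0 ?ltr0n// exprn_ege1// ler1n. Qed.

Lemma mul_pow (t : R) n : t < N ^- n.+1 -> N * t < N ^- n.
Proof.
move=> tn; rewrite mulrC -ltr_pdivlMr ?ltr0n//.
by move: tn; rewrite exprS invfM mulrC.
Qed.

Lemma piece_cons i j x : piece S K [:: i] x -> piece S K j (label S i x) ->
  piece S K (i :: j) x.
Proof. by move=> /label_piece[_ {2}<-] [y Ky <-]; exists y. Qed.

(** The first [n] digits of [t] vanish, so at every level the first link is selected, and this link
    starts at the pulled back [x]. *)
Lemma start_piece n x y t : good_state (x, y, t) -> t < N ^- n ->
  piece S K (word (code (x, y, t)) n) x.
Proof.
elim: n x y t => [|n IH] x y t gv tn; first by case: gv => Kx _ _; exists x.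
have gs := step_good gv; rewrite code_word.
have [/= Kx Ky /andP[t0 t1]] := gv; have [zx zy zP] := ziP Kx Ky.
have Nt := mul_pow tn.
have d0 : digit t = 0%N.
  by rewrite /digit (@truncn_def _ _ 0%N) ?min0n// mulr_ge0 ?ler0n//= (lt_le_trans Nt (pow_le1 n)).
have [ix iz] := zP _ (ltn0Sn _).
apply: piece_cons; rewrite /state_index /= d0; first by rewrite -{2}zx.
have := gs; rewrite /step /= d0 zx subr0 => gs'; exact: IH.
Qed.

Lemma end_piece n x y t : good_state (x, y, t) -> 1 - t < N ^- n ->
  piece S K (word (code (x, y, t)) n) y.
Proof.
elim: n x y t => [|n IH] x y t gv tn; first by case: gv => _ Ky _; exists y.
have gs := step_good gv; rewrite code_word.
have [/= Kx Ky /andP[t0 t1]] := gv; have [zx zy zP] := ziP Kx Ky.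
have Nt := mul_pow tn; have n1 := pow_le1 n.
have NE : N = m%:R + 1 by rewrite /N -natr1.
have dm : digit t = m.
  apply/minn_idPr; rewrite truncn_ge_nat ?mulr_ge0 ?ler0n//.
  by move: Nt; rewrite mulrBr mulr1; lra.
have [ix iz] := zP _ (ltnSn m).
apply: piece_cons; rewrite /state_index /= dm; first by rewrite -{2}zy.
have := gs; rewrite /step /= dm zy => gs'; apply: IH => //.
by apply: le_lt_trans Nt; rewrite mulrBr mulr1; lra.
Qed.

(** Equal first digits allow zooming into the common link. Otherwise the digits are consecutive, and
    the chain point between the two links is the end of one and the start of the other, to which
    [end_piece] and [start_piece] apply. *)
Lemma near_pieces n x y s t : good_state (x, y, s) -> good_state (x, y, t) ->
  s <= t -> t - s < N ^- n -> exists z, piece S K (word (code (x, y, s)) n) z /\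
    piece S K (word (code (x, y, t)) n) z.
Proof.
elim: n x y s t => [|n IH] x y s t gs gt st tn.
  by case: gs => Kx _ _; exists x; split; exists x.
have gs' := step_good gs; have gt' := step_good gt; rewrite !code_word.
have [/= Kx Ky s01] := gs; have [_ _ /= t01] := gt; have [zx zy zP] := ziP Kx Ky.
have Nst := mul_pow tn; have n1 := pow_le1 n.
have [ds sP] := digitP s01; have [dt tP] := digitP t01.
have dst : (digit s <= digit t)%N.
  rewrite leq_min geq_minr andbT; apply: leq_trans (geq_minl _ _) _.
  by apply: le_truncn; rewrite ler_wpM2l ?ler0n.
have [dE|dlt] := leqP (digit t) (digit s).
  have {dE} dE : digit t = digit s by apply/eqP; rewrite eqn_leq dE.
  rewrite /step /= dE in gt'.
  have [||z [sz tz]] := IH _ _ _ _ gs' gt'.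
  - by rewrite lerD2r ler_wpM2l ?ler0n.
  - by apply: le_lt_trans Nst; rewrite /= mulrBr; lra.
  exists (S (state_index (x, y, s)) z); split.
    by case: sz => w Kw <-; exists w.
  by move: tz; rewrite /state_index /step /= dE => -[w Kw <-]; exists w.
have dS : digit t = (digit s).+1.
  apply/eqP; rewrite eqn_leq dlt andbT -ltnS -(ltr_nat R) -!natr1.
  move: Nst sP tP; rewrite mulrBr => ? /andP[? ?] /andP[? ?]; lra.
exists ((zi (x, y)).1 (digit t)); have [iz0 iz1] := zP _ ds; have [jz0 jz1] := zP _ dt.
move: Nst sP tP; rewrite mulrBr dS -natr1 => ? /andP[? ?] /andP[? ?].
split; apply: piece_cons.
- exact: iz1.
- by apply: end_piece; [exact: gs'|rewrite /=; lra].
- by rewrite -dS; exact: jz0.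
- by rewrite /state_index /= -dS; apply: (start_piece gt'); rewrite /= dS -natr1; lra.
Qed.

End states.

Lemma K_path_connected : path_connected K.
Proof.
move=> x y Kx Ky; have [i0 _] := K_cover K_attr Kx.
have /choice[zi ziP] : forall v : X * X, exists zi : (nat -> X) * (nat -> 'I_m),
    K v.1 -> K v.2 -> [/\ zi.1 0%N = v.1, zi.1 m.+1 = v.2 & forall s, (s < m.+1)%N ->
    piece S K [:: zi.2 s] (zi.1 s) /\ piece S K [:: zi.2 s] (zi.1 s.+1)].
  move=> [u v] /=; have [[Ku Kv]|uv] := pselect (K u /\ K v).
    by have [zi] := chain_seq i0 (chain_K Ku Kv); exists zi.
  by exists (fun=> u, fun=> i0) => Ku Kv; case: uv.
have {}ziP u v := ziP (u, v).
have /choice[f fP] := fun t : R => address_point (code zi (x, y, t)).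
have gv t : 0 <= t <= 1 -> good_state (x, y, t) by [].
have N0 n : 0 < (m.+1%:R : R) ^- n by rewrite invr_gt0 exprn_gt0.
have [e e0|t t01|g [guc gK gE _]] := @clamp_path _ _ f K.
- have e20 : 0 < e / 2 by lra.
  have [n nP] := piece_small S_contr K_attr e20.
  exists (m.+1%:R ^- n) => // s t.
  wlog st : s t / s <= t.
    move=> H s01 t01; have [/H|/ltW/H h] := leP s t; first exact.
    by rewrite distrC metric_sym; exact: h.
  move=> s01 t01; rewrite distrC ger0_norm ?subr_ge0// => std.
  have [z [sz tz]] := near_pieces ziP (gv s s01) (gv t t01) st std.
  apply: (@mdist_lt_split _ _ _ z); first by apply: nP (fP s n) sz; rewrite size_word.
  by apply: nP tz (fP t n); rewrite size_word.
- exact: (piece_sub_K K_attr) (fP t 0%N).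
have fdist z t : (forall n, piece S K (word (code zi (x, y, t)) n) z) -> f t = z.
  move=> tz; apply: dist_le_eq0 => e e0; have [n nP] := piece_small S_contr K_attr e0.
  by apply: nP (fP t n) (tz n); rewrite size_word.
exists g; split=> //.
- rewrite gE ?lexx ?ler01//; apply: fdist => n; apply: start_piece => //.
  by apply: gv; rewrite lexx ler01.
- rewrite gE ?lexx ?ler01//; apply: fdist => n; apply: end_piece => //.
    by apply: gv; rewrite lexx ler01.
  by rewrite subrr.
Qed.

End connected_attractor.

(** * Retractions onto the pieces *)

Section retractions.
Context {R : realType} {X : metricType R} {m : nat}.
Variables (S : 'I_m -> X -> X) (K : set X).
Implicit Types (i l : 'I_m) (j : seq 'I_m) (a : nat -> 'I_m) (x y z p b : X).
Implicit Types (A D E U V F : set X).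
Hypothesis S_inj : forall i, injective (S i).
Hypothesis S_contr : forall i, contractive (S i).
Hypothesis K_attr : attractor S K.
Hypothesis K_conn : connected K.
Hypothesis K_acyclic : forall L, simple_closed_curve L -> ~ (L `<=` K).
Hypothesis bd_fin : finite_set (boundary S K).

Let piece_K j : piece S K j `<=` K := @piece_sub_K _ _ _ _ _ K_attr j.

Lemma critical_meet i l b : l != i -> piece S K [:: i] b -> piece S K [:: l] b ->
  critical S K b.
Proof. by move=> li ib lb; exists i => //; exists l. Qed.

Lemma boundary_label i b : critical S K b \/ boundary S K b -> piece S K [:: i] b ->
  boundary S K (label S i b).
Proof.
move=> bb [y Ky /= yb]; rewrite -{}yb in bb *; rewrite label_S //; split=> //.
case: bb => [Cb|[_ [j j0 Cb]]]; first by exists [:: i].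
by exists (rcons j i); rewrite -?size_eq0 ?size_rcons // -cats1 S_word_cat.
Qed.

Lemma critical_finite : finite_set (critical S K).
Proof.
apply: (@sub_finite_set _ _ (\bigcup_(i in [set: 'I_m]) (S i @` boundary S K))).
  move=> b Cb; have [i _ [l li [ib lb]]] := Cb.
  exists i => //; exists (label S i b); first by apply: boundary_label => //; left.
  by case: ib => y Ky <-; rewrite label_S.
by apply: bigcup_finite => // i _; exact: finite_image.
Qed.

Definition others i := [pred l | l != i].

(** The connected component of the cell [l] in the graph of cells with [i] removed; the union of its
    cells is a branch of [K] at the piece [i]. *)
Definition branch i l := [pred k | connect (meets_in S K (others i)) l k].

Lemma branch_others i l k : l != i -> branch i l k -> k != i.
Proof.
move=> li /connectP[p + ->]; elim: p l li => [|h p IH] l li //= /andP[/and3P[_ hi _]].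
exact: IH.
Qed.

Lemma cells_K J : cells S K J `<=` K.
Proof. by move=> x [i _]; exact: piece_K. Qed.

Lemma piece_path_connected i : path_connected (piece S K [:: i]).
Proof.
move=> _ _ [x Kx <-] [y Ky <-]; apply: path_image; first exact: S_lipschitz.
exact: K_path_connected.
Qed.

Lemma branch_path_connected i l : path_connected (cells S K (branch i l)).
Proof.
suff key k x y : branch i l k -> piece S K [:: l] x -> piece S K [:: k] y ->
    path_in (cells S K (branch i l)) x y.
  move=> x y [k lk kx] [k' lk' k'y]; have [z lz] := piece_nonempty K_attr [:: l].
  apply: (path_in_trans (b := z)); last exact: key lz k'y.
  have [f [fuc f0 f1 fA]] := key k z x lk lz kx.
  exists (fun t => f (1 - t)); split=> //; last 2 first.
  - by rewrite subr0.
  - by rewrite subrr.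
  move=> e /fuc[d d0 dP]; exists d => // s t st; apply: dP.
  by rewrite distrC; have -> : 1 - t - (1 - s) = s - t by lra.
move=> /connectP[p + ->]; elim/last_ind: p y => [|p h IH] y /=.
  move=> _ lx ly; apply: path_sub (piece_path_connected lx ly) => w lw.
  by exists l => //=; exact: connect0.
rewrite rcons_path last_rcons => /andP[lp ph] lx hy.
have /and3P[_ _ /asboolP[z [pz hz]]] := ph.
apply: path_in_trans (IH _ lp lx pz) _.
apply: path_sub (piece_path_connected hz hy) => w hw; exists h => //=.
by apply: connect_trans (connect1 ph); apply/connectP; exists p.
Qed.

Lemma branch_self i l x : piece S K [:: l] x -> cells S K (branch i l) x.
Proof. by move=> lx; exists l => //=; exact: connect0. Qed.

(** On a walk of cells from [l] to [i], the cell just before the first visit to [i] still belongs to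
    the branch of [l] and meets the piece [i]. *)
Lemma gate_exists i l : l != i -> exists2 z, piece S K [:: i] z & cells S K (branch i l) z.
Proof.
move=> li; have /connectP[p lp pi] := meets_connected S_contr K_attr K_conn l i.
elim: p l li lp pi => [|h p IH] l li /=; first by move=> _ il; rewrite il eqxx in li.
move=> /andP[/asboolP lh hp] ip; have [hi|hi] := eqVneq h i.
  by case: lh => z [lz]; rewrite hi => iz; exists z => //; exact: branch_self.
have [z iz [k hk kz]] := IH _ hi hp ip; exists z => //; exists k => //=.
apply: connect_trans hk; apply: connect1; rewrite /meets_in /= li hi.
exact/asboolP.
Qed.

Lemma gate_unique i l z z' : l != i -> piece S K [:: i] z -> piece S K [:: i] z' ->
  cells S K (branch i l) z -> cells S K (branch i l) z' -> z = z'.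
Proof.
move=> li iz iz' lz lz'; apply: contrapT => zz'.
have [|L Lc LK] := path_connected_closed_curve (@piece_path_connected i)
  (@branch_path_connected i l) _ (conj iz lz) (conj iz' lz') zz'.
  apply: sub_finite_set critical_finite => b [ib [k lk kb]].
  exact: critical_meet (branch_others li lk) ib kb.
by apply: (K_acyclic Lc) => x /LK[/piece_K|/cells_K].
Qed.

Definition gates i y := piece S K [:: i] `&`
  [set z | exists2 l, l != i /\ piece S K [:: l] y & cells S K (branch i l) z].

Definition retract i y := if `[< piece S K [:: i] y >] then y else xget y (gates i y).

Lemma retract_id i y : piece S K [:: i] y -> retract i y = y.
Proof. by move=> iy; rewrite /retract asboolT. Qed.

Lemma branch_eq i l k : branch i l k -> branch i k =1 branch i l.
Proof. by move=> lk h; apply/esym/same_connect => //; exact: connect_meets_inC. Qed.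

Lemma cells_eq (J J' : pred 'I_m) : J =1 J' -> cells S K J = cells S K J'.
Proof.
move=> JJ'; apply/seteqP; split=> x [k Jk kx]; exists k => //;
  by move: Jk; rewrite /= !unfold_in JJ'.
Qed.

(** The choices hidden in [gates] are harmless: all cells other than [i] that contain [y] meet at
    [y], hence lie in one branch, which has one gate. If [y] is in the piece [i], it is this gate
    itself. *)
Lemma retract_gate i l y z : l != i -> cells S K (branch i l) y ->
  piece S K [:: i] z -> cells S K (branch i l) z -> retract i y = z.
Proof.
move=> li ly iz lz; have [iy|iy] := pselect (piece S K [:: i] y).
  by rewrite retract_id//; exact: gate_unique ly lz.
rewrite /retract asboolF//; have [k lk ky] := ly.
have [|iw [h [hi hy] hw]] := @xgetPex _ y (gates i y).
  exists z; split=> //; exists k; first by split=> //; exact: branch_others lk.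
  by rewrite (cells_eq (branch_eq lk)).
have lh : branch i l h.
  apply: (connect_trans lk (connect1 _)); rewrite /meets_in /= hi.
  by rewrite (branch_others li lk); apply/asboolP; exists y.
by apply: gate_unique lz => //; move: hw; rewrite (cells_eq (branch_eq lh)).
Qed.

Lemma retract_other i l : l != i -> exists2 z, piece S K [:: i] z &
  forall y, cells S K (branch i l) y -> retract i y = z.
Proof.
move=> li; have [z iz lz] := gate_exists li.
by exists z => // y ly; exact: retract_gate lz.
Qed.

Lemma K_cases i y : K y -> piece S K [:: i] y \/ exists2 l, l != i & piece S K [:: l] y.
Proof.
move=> /(K_cover K_attr)[l ly]; have [<-|li] := eqVneq l i; first by left.
by right; exists l.
Qed.

Lemma retract_piece i y : K y -> piece S K [:: i] (retract i y).
Proof.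
move=> /(K_cases i)[iy|[l li ly]]; first by rewrite retract_id.
by have [z iz zP] := retract_other li; rewrite zP//; exact: branch_self.
Qed.

(* [S i \o rho i] retracts [K] onto the piece [i], and [rho i] extends the map [phi i]
   of the sprout from the boundary to [K]. *)
Definition rho i y := label S i (retract i y).

Lemma S_rho i y : K y -> S i (rho i y) = retract i y.
Proof. by move=> /(retract_piece i)[x Kx xE]; rewrite /rho -xE /= label_S. Qed.

Lemma rho_K i y : K y -> K (rho i y).
Proof. by move=> /(retract_piece i)[x Kx xE]; rewrite /rho -xE /= label_S. Qed.

Lemma rho_S i y : K y -> rho i (S i y) = y.
Proof. by move=> Ky; rewrite /rho retract_id ?label_S//; exists y. Qed.

(** Continuity relative to [K]: elsewhere [retract] and [label] may take default values. *)
Definition closed_continuous (g : X -> X) := forall F, closed F ->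
  exists2 F', closed F' & forall y, K y -> F (g y) <-> F' y.

(** [rho i] inverts [S i] on the piece [i] and is constant on each other cell, so the preimage of a
    closed set consists of a compact part of the piece [i] and finitely many cells. *)
Lemma rho_continuous i : closed_continuous (rho i).
Proof.
move=> F Fcl; pose J := [pred l | (l != i) && `[< exists2 y, piece S K [:: l] y & F (rho i y) >]].
have rho_cst l y y' : l != i -> piece S K [:: l] y -> piece S K [:: l] y' -> rho i y = rho i y'.
  move=> li ly ly'; have [z _ zP] := retract_other li.
  by rewrite /rho !zP//; exact: branch_self.
exists (S i @` (K `&` F) `|` cells S K J).
  apply: closedU; last exact: cells_closed.
  apply: compact_closed; first exact: metric_hausdorff.
  apply: continuous_compact; last by apply: compact_closedI => //; case: K_attr.
  exact/continuous_subspaceT/lipschitz_continuous/S_lipschitz.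
move=> y Ky; split.
  move=> Fy; have [[x Kx xy]|[l li ly]] := K_cases i Ky.
    by left; exists (rho i y); [split=> //; exact: rho_K|rewrite -xy rho_S].
  by right; exists l => //; rewrite /= inE li /=; apply/asboolP; exists y.
move=> [[x [Kx Fx] <-]|[l]]; first by rewrite rho_S.
rewrite /= inE => /andP[li /asboolP[y' ly' Fy']] ly.
by rewrite (rho_cst l y y').
Qed.

Lemma closed_continuous_connected A (g : X -> X) : A `<=` K -> closed_continuous g ->
  connected A -> connected (g @` A).
Proof.
move=> AK gc Ac B [x0 Bx0] [U Uop BU] [F Fcl BF].
have [F' F'cl F'P] := gc _ Fcl; have [U' U'cl U'P] := gc _ (open_closedC Uop).
have BFE y : A y -> B (g y) <-> F' y.
  move=> Ay; rewrite -F'P; last exact: AK.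
  by rewrite BF; split=> [[]//|Fy]; split=> //; exists y.
have [y0 Ay0 y0x0] : (g @` A) x0 by move: Bx0; rewrite BF => -[].
have BUE y : A y -> B (g y) <-> ~ U' y.
  move=> Ay; rewrite -U'P; last exact: AK.
  by rewrite BU; split=> [[_ ?]|/contrapT Uy]; [exact|split=> //; exists y].
have AF : A `&` F' = A.
  apply: Ac.
  - by exists y0; split=> //; apply/BFE => //; rewrite y0x0.
  - exists (~` U'); first exact: closed_openC.
    apply/seteqP; split=> y [Ay] ?; split=> //.
      by apply/BUE => //; apply/BFE.
    by apply/BFE => //; apply/BUE.
  - by exists F'.
apply/seteqP; split=> [x|_ [y Ay <-]]; first by rewrite BF => -[].
by apply/BFE => //; move: Ay; rewrite -{1}AF => -[].
Qed.

(** A cell of the branch and a cell outside it can meet only if the latter is [i]. If [A] avoided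
    such points, the two finite unions of cells would split it. *)
Lemma branch_gate i l A y y' : l != i -> A `<=` K -> connected A ->
  A y -> cells S K (branch i l) y -> A y' -> ~ cells S K (branch i l) y' ->
  exists z, [/\ A z, piece S K [:: i] z & cells S K (branch i l) z].
Proof.
move=> li AK Ac Ay ly Ay' ly'; apply: contrapT => noz; apply: ly'.
pose J' := [pred k | ~~ branch i l k].
have AJ' x : A x -> cells S K (branch i l) x <-> ~ cells S K J' x.
  move=> Ax; split=> [[k lk kx] [k' lk' k'x]|nJ'].
    have [k'i|k'i] := eqVneq k' i.
      by apply: noz; exists x; split=> //; [rewrite -k'i|exists k].
    move/negP: lk'; apply; apply: (connect_trans lk (connect1 _)).
    by rewrite /meets_in /= k'i (branch_others li lk); apply/asboolP; exists x.
  have [k kx] := K_cover K_attr (AK _ Ax); exists k => //=.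
  by apply: contrapT => /negP lk; apply: nJ'; exists k.
have AE : A `&` cells S K (branch i l) = A.
  apply: Ac.
  - by exists y.
  - exists (~` cells S K J'); first by apply: closed_openC; exact: cells_closed.
    by apply/seteqP; split=> x [Ax] /(AJ' x Ax) ?.
  - by exists (cells S K (branch i l)) => //; exact: cells_closed.
by move: Ay'; rewrite -AE => -[].
Qed.

(** If [y] and a point of [A] in the piece lie in the same branch, the latter is the gate of [y];
    otherwise [A] leaves the branch and crosses its gate. *)
Lemma retract_connected i A y : A `<=` K -> connected A -> A `&` piece S K [:: i] !=set0 ->
  A y -> A (retract i y).
Proof.
move=> AK Ac [y' [Ay' iy']] Ay; have [iy|[l li ly]] := K_cases i (AK _ Ay).
  by rewrite retract_id.
have lly := branch_self i ly.
have [ly'|ly'] := pselect (cells S K (branch i l) y').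
  by rewrite (retract_gate li lly iy' ly').
by have [z [Az iz lz]] := branch_gate li AK Ac Ay lly Ay' ly'; rewrite (retract_gate li lly iz lz).
Qed.

Lemma retract_disjoint i A y y' : A `<=` K -> connected A ->
  ~ (A `&` piece S K [:: i] !=set0) -> A y -> A y' -> retract i y = retract i y'.
Proof.
move=> AK Ac Ai Ay Ay'; have [iy|[l li ly]] := K_cases i (AK _ Ay).
  by case: Ai; exists y.
have lly := branch_self i ly; have [z _ zP] := retract_other li; rewrite !zP//.
apply: contrapT => ly'; have [z' [Az' iz' _]] := branch_gate li AK Ac Ay lly Ay' ly'.
by case: Ai; exists z'.
Qed.

(** * Retractions onto the pieces of arbitrary words *)

Definition rho_word j y := foldl (fun q i => rho i q) y j.

Lemma rho_word_K j y : K y -> K (rho_word j y).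
Proof. by elim: j y => [|i j IH] y //= Ky; apply: IH; exact: rho_K. Qed.

Lemma rho_wordK j y : piece S K j y -> S_word S j (rho_word j y) = y.
Proof.
elim: j y => [|i j IH] y //= [x Kx <-] /=.
have Kjx : K (S_word S j x) by apply: (@piece_K j); exists x.
by rewrite rho_S// IH//; exists x.
Qed.

Lemma rho_image_connected i A : A `<=` K -> connected A -> connected (rho i @` A).
Proof. by move=> AK; apply: closed_continuous_connected => //; exact: rho_continuous. Qed.

Lemma rho_image_K i A : A `<=` K -> rho i @` A `<=` K.
Proof. by move=> AK _ [y /AK Ky <-]; exact: rho_K. Qed.

Lemma rho_word_connected j A y : A `<=` K -> connected A -> A `&` piece S K j !=set0 ->
  A y -> A (S_word S j (rho_word j y)).
Proof.
elim: j A y => [|i j IH] A y // AK Ac [x [Ax ijx]] Ay /=.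
have Ai : A `&` piece S K [:: i] !=set0.
  by exists x; split=> //; exact: (piece_cat K_attr (j := [:: i]) (k := j)) ijx.
have [||w Aw wE] := IH (rho i @` A) (rho i y) (rho_image_K AK) (rho_image_connected AK Ac).
- case: ijx => w Kw wx; exists (S_word S j w); split; last by exists w.
  exists x => //; rewrite -wx /= rho_S//; apply: (@piece_K j).
  by exists w.
- by exists y.
- by rewrite -wE S_rho; [exact: retract_connected|exact: AK].
Qed.

Lemma rho_word_disjoint j A y y' : A `<=` K -> connected A ->
  ~ (A `&` piece S K j !=set0) -> A y -> A y' -> rho_word j y = rho_word j y'.
Proof.
elim: j A y y' => [|i j IH] A y y' AK Ac Aj Ay Ay' /=.
  by case: Aj; exists y; split=> //; exists y => //; exact: AK.
have [Ai|Ai] := pselect (A `&` piece S K [:: i] !=set0); last first.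
  by congr rho_word; rewrite /rho (@retract_disjoint i A y y').
apply: (IH (rho i @` A)); [exact: rho_image_K|exact: rho_image_connected|
  |by exists y|by exists y'].
(* If the image of [A] under [rho i] met the piece [j], applying [S i] would give a point of the
   piece [i :: j], still in [A] because [A] is stable under the retraction. *)
move=> [_ [[w Aw <-] [v Kv vw]]]; apply: Aj; exists (S i (rho i w)); split.
  by rewrite S_rho; [exact: retract_connected|exact: AK].
by exists v => //=; rewrite vw.
Qed.

Lemma rho_word_image_connected j A : A `<=` K -> connected A ->
  connected (rho_word j @` A) /\ rho_word j @` A `<=` K.
Proof.
elim: j A => [|i j IH] A AK Ac.
  by have -> : rho_word [::] @` A = A by apply/seteqP; split=> [_ [x Ax <-]|x Ax]; [|exists x].
have [c s] := IH _ (rho_image_K (i := i) AK) (rho_image_connected (i := i) AK Ac).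
suff -> : rho_word (i :: j) @` A = rho_word j @` (rho i @` A) by [].
apply/seteqP; split=> [_ [x Ax <-]|_ [_ [x Ax <-] <-]]; last by exists x.
by exists (rho i x) => //; exists x.
Qed.

(** When nonempty, the intersection is the image of [A] under the retraction onto the piece [j]. *)
Lemma connected_piece j A : A `<=` K -> connected A -> connected (A `&` piece S K j).
Proof.
move=> AK Ac; have [Aj|Aj] := pselect (A `&` piece S K j !=set0); last first.
  suff -> : A `&` piece S K j = set0 by exact: connected0.
  by apply: contrapT => /eqP/set0P.
suff -> : A `&` piece S K j = S_word S j @` (rho_word j @` A).
  have [c _] := rho_word_image_connected j AK Ac.
  apply: connected_continuous_connected => //.
  exact/continuous_subspaceT/S_word_continuous.
apply/seteqP; split=> [x [Ax jx]|_ [_ [x Ax <-] <-]].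
  by exists (rho_word j x); [exists x|rewrite rho_wordK].
split; first exact: rho_word_connected.
by exists (rho_word j x) => //; apply: rho_word_K; exact: AK.
Qed.

End retractions.

(** * Subcontinua and the sprout *)

Lemma card_ge2 (T : Type) (A : set T) : `I_2 #<= A -> exists x y, [/\ A x, A y & x <> y].
Proof.
move=> A2; apply: contrapT => nA; have [A0|/set0P[x Ax]] := eqVneq A set0.
  by move: A2; rewrite A0 card_le0 => /eqP h; have : `I_2 0%N by []; rewrite h.
have A1 : A `<=` [set x].
  by move=> y Ay; apply: contrapT => yx; apply: nA; exists x, y; split=> // xy; apply: yx.
have := card_le_trans A2 (subset_card_le A1).
by rewrite (card_le_eqr (card_set1 (x := x))) card_le_II.
Qed.

Section stars.
Context {R : realType} {X : metricType R} {m : nat}.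
Variables (S : 'I_m -> X -> X) (K : set X).
Implicit Types (i l : 'I_m) (j : seq 'I_m) (a : nat -> 'I_m) (x y z p q b : X).
Implicit Types (A D E U V F : set X).
Hypothesis S_inj : forall i, injective (S i).
Hypothesis S_contr : forall i, contractive (S i).
Hypothesis K_attr : attractor S K.
Hypothesis K_conn : connected K.
Hypothesis K_acyclic : forall L, simple_closed_curve L -> ~ (L `<=` K).
Hypothesis bd_fin : finite_set (boundary S K).

Let piece_K j : piece S K j `<=` K := @piece_sub_K _ _ _ _ _ K_attr j.

Lemma word_cover n x : K x -> exists2 j, size j = n & piece S K j x.
Proof.
move=> Kx; elim: n => [|n [j jn jx]]; first by exists [::] => //; exists x.
by have [i jix] := piece_split K_attr jx; exists (rcons j i); rewrite ?size_rcons ?jn.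
Qed.

Lemma words_finite n : finite_set [set j : seq 'I_m | size j = n].
Proof.
apply: (@sub_finite_set _ _ (@tval n 'I_m @` setT)).
  by move=> j /eqP jn; exists (Tuple jn).
by apply: finite_image; exact: finite_finset.
Qed.

Lemma pieces_closed n (P : set (seq 'I_m)) :
  closed (\bigcup_(j in [set j | size j = n /\ P j]) piece S K j).
Proof.
apply: closed_bigcup => [|j _]; last exact: piece_closed.
by apply: sub_finite_set (words_finite n) => j [].
Qed.

(** The stars are arbitrarily small neighbourhoods of [y] in [K], and they cut every connected
    subset of [K] through [y] in a connected set. They thus give local connectedness of all
    connected subsets. *)
Definition star n y := \bigcup_(j in [set j | size j = n /\ piece S K j y]) piece S K j.

Lemma star_self n y : K y -> star n y y.
Proof. by move=> /(word_cover n)[j jn jy]; exists j. Qed.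

Lemma star_nbhs n y : exists V, [/\ open V, V y & K `&` V `<=` star n y].
Proof.
exists (~` \bigcup_(j in [set j | size j = n /\ ~ piece S K j y]) piece S K j); split.
- by apply: closed_openC; exact: pieces_closed.
- by move=> [j []].
- move=> x [/(word_cover n)[j jn jx] nx]; exists j => //; split=> //.
  by apply: contrapT => jy; apply: nx; exists j.
Qed.

Lemma star_small U y : open U -> U y -> exists n, star n y `<=` U.
Proof.
move=> Uop Uy; have /nbhs_ballP[e /= e0 eU] : nbhs y U by exact: open_nbhs_nbhs.
have [n nP] := piece_small S_contr K_attr e0; exists n => x [j [jn jy] jx].
by apply: eU; rewrite ballEmdist; apply: nP jy jx; rewrite jn.
Qed.

Lemma star_connected n A y : A `<=` K -> connected A -> A y -> connected (A `&` star n y).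
Proof.
move=> AK Ac Ay; rewrite /star setI_bigcupr; apply: bigcup_connected.
  by exists y => j [_ jy].
by move=> j _; exact: connected_piece.
Qed.

Lemma component_open D U y : D `<=` K -> connected D -> open U ->
  exists2 V, open V & connected_component (D `&` U) y = D `&` V.
Proof.
move=> DK Dc Uop; pose Q := connected_component (D `&` U) y.
have QDU : Q `<=` D `&` U by exact: connected_component_sub.
have /choice[V VP] : forall z, exists V, Q z -> [/\ open V, V z & D `&` V `<=` Q].
  move=> z; have [Qz|Qz] := pselect (Q z); last by exists set0.
  have [Dz Uz] := QDU _ Qz; have [n nU] := star_small Uop Uz.
  have [V [Vop Vz Vn]] := star_nbhs n z; exists V => _; split=> // x [Dx Vx].
  apply: (connected_component_trans Qz).
  apply: (@connected_component_max _ _ (D `&` star n z)).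
  - by split=> //; apply: star_self; exact: DK.
  - by move=> w [Dw /nU Uw].
  - exact: star_connected.
  - by split=> //; apply: Vn; split=> //; exact: DK.
exists (\bigcup_(z in Q) V z); first by apply: bigcup_open => z /VP[].
apply/seteqP; split=> [z Qz|x [Dx [z /VP[_ _ zQ] Vx]]]; last exact: zQ.
by have [Dz _] := QDU _ Qz; split=> //; exists z => //; have [] := VP z Qz.
Qed.

Lemma continuum_subdendrite D : D !=set0 -> closed D -> D `<=` K -> connected D ->
  subdendrite K D.
Proof.
move=> D0 Dcl DK Dc; split=> //; split.
- split=> //; rewrite -(setIidr DK); apply: compact_closedI => //.
  by case: K_attr.
- move=> x U Dx Uop Ux; have [V Vop VE] := component_open x DK Dc Uop.
  exists V; rewrite -VE; split=> //.
  + by have [] : (D `&` V) x by rewrite -VE; exact: connected_component_refl.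
  + by move=> z /connected_component_sub[].
  + exact: component_connected.
- by move=> L Lc LD; apply: (K_acyclic Lc); exact: subset_trans DK.
Qed.

(** The points that such an [E] joins to [p] form an open and closed subset of the component, since
    a small star can be added to [E]. Being closed, [E] stays away from the small pieces at a point
    outside [U]. *)
Lemma component_continuum D U p q : closed D -> D `<=` K -> connected D -> open U ->
  connected_component (D `&` U) p q ->
  exists E, [/\ closed E, connected E, E p, E q & E `<=` D `&` U].
Proof.
move=> Dcl DK Dc Uop pq; pose Q := connected_component (D `&` U) p.
have QDU : Q `<=` D `&` U by exact: connected_component_sub.
pose B := [set q | Q q /\ exists E, [/\ closed E, connected E, E p, E q & E `<=` D `&` U]].
suff BQ : B = Q by have [] : B q by rewrite BQ.
have /choice[V VP] : forall z, exists V, Q z ->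
    [/\ open V, V z & forall x, Q x -> V x -> B x <-> B z].
  move=> z; have [Qz|Qz] := pselect (Q z); last by exists set0.
  have [Dz Uz] := QDU _ Qz; have [n nU] := star_small Uop Uz.
  have [V [Vop Vz Vn]] := star_nbhs n z; exists V => _; split=> // x Qx Vx.
  have [Dx Ux] := QDU _ Qx.
  pose N := D `&` star n z.
  have Nz : N z by split=> //; apply: star_self; exact: DK.
  have Nx : N x by split=> //; apply: Vn; split=> //; exact: DK.
  have Ncl : closed N by apply: closedI => //; exact: pieces_closed.
  have Nc : connected N by exact: star_connected.
  have NU : N `<=` D `&` U by move=> w [Dw /nU].
  split=> -[_ [E [Ecl Ec Ep Ew EU]]]; split=> //; exists (E `|` N); split.
  - exact: closedU.
  - by apply: connectedU => //; exists x.
  - by left.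
  - by right.
  - by rewrite subUset.
  - exact: closedU.
  - by apply: connectedU => //; exists z.
  - by left.
  - by right.
  - by rewrite subUset.
have Qp : Q p.
  apply: connected_component_refl; apply: contrapT => nDUp.
  by move: pq; rewrite connected_component_out.
apply: (@component_connected _ (D `&` U) p).
- exists p; split=> //; exists [set p]; split=> //; last by move=> _ ->; exact: QDU.
  + exact/accessible_closed_set1/hausdorff_accessible/metric_hausdorff.
  + exact: connected1.
- exists (\bigcup_(z in B) V z); first by apply: bigcup_open => z [/VP[]].
  apply/seteqP; split=> [z Bz|x [Qx [z Bz Vx]]].
    by have [Qz _] := Bz; split=> //; exists z => //; have [] := VP z Qz.
  have [Qz _] := Bz; have [_ _ h] := VP z Qz; exact/(h x Qx Vx).
- exists (~` \bigcup_(z in Q `\` B) V z).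
    by apply: open_closedC; apply: bigcup_open => z [/VP[]].
  apply/seteqP; split=> [z Bz|x [Qx nx]].
    have [Qz _] := Bz; split=> // -[w [Qw Bw] Vz]; apply: Bw.
    by have [_ _ h] := VP w Qw; exact/(h z Qz Vz).
  apply: contrapT => Bx; apply: nx; exists x => //.
  by have [] := VP x Qx.
Qed.

Lemma component_continuum_finite D U p F : closed D -> D `<=` K -> connected D -> open U ->
  (D `&` U) p -> finite_set F -> F `<=` connected_component (D `&` U) p ->
  exists E, [/\ closed E, connected E, E p, F `<=` E & E `<=` D `&` U].
Proof.
move=> Dcl DK Dc Uop DUp /finite_seqP[s ->].
elim: s => [|q s IH] sQ.
  exists [set p]; split=> //; last by move=> _ ->.
  + exact/accessible_closed_set1/hausdorff_accessible/metric_hausdorff.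
  + exact: connected1.
have [E [Ecl Ec Ep sE EU]] : exists E,
    [/\ closed E, connected E, E p, [set` s] `<=` E & E `<=` D `&` U].
  by apply: IH => z zs; apply: sQ; rewrite /= inE; apply/orP; right.
have [E' [E'cl E'c E'p E'q E'U]] : exists E,
    [/\ closed E, connected E, E p, E q & E `<=` D `&` U].
  by apply: component_continuum => //; apply: sQ; rewrite /= inE eqxx.
exists (E `|` E'); split=> //.
- exact: closedU.
- by apply: connectedU => //; exists p.
- by left.
- by move=> z; rewrite /= inE => /predU1P[->|/sE]; [right|left].
- by rewrite subUset.
Qed.

(** * Agreement of the retractions with the maps of the sprout *)

Let adj := fun u v : 'I_m + X => `[< Defs.adjacent S K u v >].

(** [r] sends a vertex to the gate of its point or cell; any point of a cell other than [i] will do,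
    as they share one gate. So [r] is constant along edges that avoid the white vertex [i], and the
    last black vertex, lying in the piece [i], is its own gate. *)
Lemma last_edge_retract i p b : K p -> last_edge S K i p b -> b = retract S K i p.
Proof.
move=> Kp [s [+ + sb]]; rewrite rcons_path sb => /andP[ps /asboolP[_ ib]].
rewrite -rcons_cons rcons_uniq => /andP[+ _]; rewrite inE negb_or => /andP[_ si].
rewrite -[LHS](retract_id ib); have [k0 Kk0] : K !=set0 by case: K_attr.
pose r (v : 'I_m + X) :=
  match v with inr x => retract S K i x | inl l => retract S K i (S l k0) end.
have rE l x : l != i -> piece S K [:: l] x -> r (inl l) = retract S K i x.
  move=> li lx; have [z _ zP] := retract_other S_inj S_contr K_attr K_conn K_acyclic bd_fin li.
  by rewrite /r !zP//; apply: branch_self => //; exists k0.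
suff key : forall u, inl i != u -> path adj u s -> r (last u s) = r u.
  by have := key (inr p) isT ps; rewrite sb.
elim: s si {ps sb} => [|v s IH] // + u ui /= /andP[/asboolP uv vs].
rewrite inE negb_or => /andP[iv si]; rewrite IH//.
case: u v ui iv uv {IH vs} => [l|x] [l'|x'] //= ui iv [_ lx].
- by symmetry; apply: rE => //; rewrite eq_sym.
- by apply: rE => //; rewrite eq_sym.
Qed.

(** Two distinct cells that meet share a critical point, so a walk of cells becomes a walk of the
    sprout, which [shortenP] makes simple. *)
Lemma last_edge_exists i p : boundary S K p -> exists b, last_edge S K i p b.
Proof.
move=> Pp; have Kp : K p by case: Pp.
pose reach v := exists2 s, path adj (inr p) s & last (inr p) s = v.
have reach_step u v : reach u -> adj u v -> reach v.
  by move=> [s ps <-] uv; exists (rcons s v); rewrite ?rcons_path ?ps ?last_rcons.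
have [l lp] := K_cover K_attr Kp.
have [s ps si] : reach (inl i).
  have : reach (inl l).
    by exists [:: inl l] => //=; rewrite andbT; apply/asboolP; split=> //; right.
  have /connectP[t + ->] := meets_connected S_contr K_attr K_conn l i.
  elim: t l {lp} => [|h t IH] l //= /andP[/asboolP[z [lz hz]] ht] rl; apply: IH ht _.
  have [<-//|lh] := eqVneq l h.
  have bz : black S K z by left; exact: critical_meet hz lz.
  apply: (reach_step (inr z)); last exact/asboolP.
  by apply: reach_step rl _; exact/asboolP.
move: si; case/shortenP: ps => s' ps' us' _ si.
case/lastP: s' ps' us' si => [//|s' v]; rewrite last_rcons => ps' us' vi.
rewrite {v}vi in ps' us'.
have := ps'; rewrite rcons_path => /andP[_ /asboolP].
by case sE : (last _ s') => [h|b] // _; exists b, s'.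
Qed.

Lemma phi_rho i p : boundary S K p -> phi S K i p = rho S K i p.
Proof.
move=> Pp; rewrite /phi /rho; congr label.
have := xgetPex p (last_edge_exists i Pp).
by apply: last_edge_retract; case: Pp.
Qed.

Lemma rho_boundary i p : boundary S K p -> boundary S K (rho S K i p).
Proof.
move=> Pp; have Kp : K p by case: Pp.
have [ip|[l li lp]] := K_cases K_attr i Kp.
  by rewrite /rho retract_id//; apply: boundary_label => //; right.
have [z iz lz] := gate_exists S_contr K_attr K_conn li.
rewrite /rho (@retract_gate _ _ _ _ _ S_inj S_contr K_attr K_conn K_acyclic bd_fin i l p z)//.
  apply: boundary_label => //; left; have [k lk kz] := lz.
  exact: critical_meet (branch_others li lk) iz kz.
exact: branch_self.
Qed.

Lemma phi_word_rho j p : boundary S K p -> phi_word S K j p = rho_word S K j p.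
Proof.
elim: j p => [|i j IH] p Pp //=.
rewrite /phi_word /= phi_rho//; exact/IH/rho_boundary.
Qed.

(** Two edges at one white vertex have distinct labels, since [S i] maps the labels to the two black
    vertices. *)
Lemma regular_boundary : regular S K -> exists p q, [/\ boundary S K p, boundary S K q & p <> q].
Proof.
move=> [regW _]; have [x Kx] : K !=set0 by case: K_attr.
have [i _] := K_cover K_attr Kx.
have [[l|b] [[l'|b'] [//= [bb ib] [bb' ib'] neq]]] := card_ge2 (regW i).
exists (label S i b), (label S i b'); split; [exact: boundary_label..|].
move=> lbb'; apply: neq; congr inr.
case: ib ib' lbb' => [y Ky <-] [y' Ky' <-]; rewrite /= !label_S// => -> //.
Qed.

End stars.

(** * Components of the main tree minus a point *)

Section main_tree_components.
Context {R : realType} {X : metricType R} {m : nat}.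
Variables (S : 'I_m -> X -> X) (K : set X).
Implicit Types (i l : 'I_m) (j k : seq 'I_m) (a b : nat -> 'I_m) (x y z p q : X).
Implicit Types (A D E U V F Q : set X).
Hypothesis S_inj : forall i, injective (S i).
Hypothesis S_contr : forall i, contractive (S i).
Hypothesis K_attr : attractor S K.
Hypothesis K_conn : connected K.
Hypothesis K_acyclic : forall L, simple_closed_curve L -> ~ (L `<=` K).
Hypothesis bd_fin : finite_set (boundary S K).

Let piece_K j : piece S K j `<=` K := @piece_sub_K _ _ _ _ _ K_attr j.

Lemma piece_connected j : connected (piece S K j).
Proof.
apply: connected_continuous_connected => //.
exact/continuous_subspaceT/S_word_continuous.
Qed.

(** After the common prefix is stripped, the words start with distinct letters [i] and [l], and a
    common point is the unique gate of the cell [i] towards the branch of [l]. *)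
Lemma pieces_meet j k y z : size j = size k -> j != k ->
  piece S K j y -> piece S K k y -> piece S K j z -> piece S K k z -> y = z.
Proof.
elim: j k y z => [|i j IH] [|l k] y z //= [jk] ijlk jy ky jz kz.
have [il|il] := eqVneq i l.
  rewrite -{l}il eqseq_cons eqxx /= in ijlk ky kz.
  have [y' Ky' yE] := ky; have [z' Kz' zE] := kz; rewrite -yE -zE /= in jy jz *.
  congr S; apply: (IH k) => //; [|by exists y'| |by exists z'].
  - by case: jy => w Kw /= /S_inj <-; exists w.
  - by case: jz => w Kw /= /S_inj <-; exists w.
have li : l != i by rewrite eq_sym.
apply: (@gate_unique _ _ _ _ _ S_inj S_contr K_attr K_conn K_acyclic bd_fin i l) => //.
- exact: (piece_cat K_attr (j := [:: i]) (k := j)) jy.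
- exact: (piece_cat K_attr (j := [:: i]) (k := j)) jz.
- by apply: branch_self; exact: (piece_cat K_attr (j := [:: l]) (k := k)) ky.
- by apply: branch_self; exact: (piece_cat K_attr (j := [:: l]) (k := k)) kz.
Qed.

Lemma addressP a y : addresses S K y a <-> forall n, piece S K (word a n) y.
Proof.
split=> [ay n|ay].
  by have : [set y] y by []; rewrite -ay => /(_ n I).
apply/seteqP; split=> [z az|_ -> n _]; last exact: ay.
apply: dist_le_eq0 => e e0; have [n nP] := piece_small S_contr K_attr e0.
by apply: nP (az n I) (ay n); rewrite size_word.
Qed.

Lemma address_small a y U : addresses S K y a -> open U -> U y ->
  exists n0, forall n, (n0 <= n)%N -> piece S K (word a n) `<=` U.
Proof.
move=> /addressP ay Uop Uy; have [n0 n0U] := star_small S_contr K_attr Uop Uy.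
exists n0 => n n0n; apply: subset_trans n0U => z /(piece_word_mono K_attr n0n) nz.
by exists (word a n0); rewrite /= ?size_word.
Qed.

Definition retr j y := S_word S j (rho_word S K j y).

Lemma retr_inj j y z : retr j y = retr j z -> rho_word S K j y = rho_word S K j z.
Proof. exact: S_word_inj. Qed.

Lemma retr_piece j y : K y -> piece S K j (retr j y).
Proof. by move=> Ky; exists (rho_word S K j y) => //; exact: rho_word_K. Qed.

Variable G : set X.
Hypothesis G_main : main_tree S K G.

Lemma boundary_G : boundary S K `<=` G. Proof. by case: G_main. Qed.

Lemma G_K : G `<=` K. Proof. by case: G_main => -[]. Qed.

Lemma G_conn : connected G. Proof. by case: G_main => -[_ [[]]]. Qed.

Lemma G_closed : closed G.
Proof.
by case: G_main => -[_ [[_ ? _] _ _]] _ _; apply: compact_closed => //; exact: metric_hausdorff.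
Qed.

Lemma G_min D : D !=set0 -> closed D -> D `<=` K -> connected D -> boundary S K `<=` D ->
  G `<=` D.
Proof. by move=> *; case: G_main => _ _; apply => //; exact: continuum_subdendrite. Qed.

Lemma outside_constant a y : addresses S K y a -> ~ G y -> exists n0, forall n p q,
  (n0 <= n)%N -> boundary S K p -> boundary S K q ->
  rho_word S K (word a n) p = rho_word S K (word a n) q.
Proof.
move=> ay Gy; have [n0 n0P] := address_small ay (closed_openC G_closed) Gy.
exists n0 => n p q n0n /boundary_G Gp /boundary_G Gq.
apply: (rho_word_disjoint S_inj S_contr K_attr K_conn K_acyclic bd_fin G_K G_conn) => //.
by move=> [z [Gz nz]]; exact: (n0P n n0n z).
Qed.

Variable x : X.
Hypothesis Gx : G x.

Let W := G `\ x.
Let co y := connected_component W y.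
Let U0 : set X := ~` [set x].

Let WE : W = G `&` U0. Proof. by rewrite /W setDE. Qed.

Let U0op : open U0.
Proof. exact/closed_openC/accessible_closed_set1/hausdorff_accessible/metric_hausdorff. Qed.

Lemma co_open y : exists2 V, open V & co y = G `&` V.
Proof. by rewrite /co WE; apply: (@component_open _ _ _ S K) => //; [exact: G_K|exact: G_conn]. Qed.

Lemma closure_sub_G y : closure (co y) `<=` G.
Proof.
rewrite (closure_id G).1; last exact: G_closed.
by apply: closureS => z /connected_component_sub[].
Qed.

(** Components are open in [G], so no other component contains a limit point of [co y]. Without [x]
    as a limit point, [co y] would be open and closed in the connected set [G]. *)
Lemma closure_co y : W y -> closure (co y) = co y `|` [set x].
Proof.
move=> Wy; have sub : closure (co y) `<=` co y `|` [set x].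
  move=> z cz; have [->|zx] := pselect (z = x); first by right.
  left; have Wz : W z by split=> //; exact: closure_sub_G cz.
  have [V Vop VE] := co_open z; have : co z z by exact: connected_component_refl.
  rewrite VE => -[_ Vz]; have [w [yw Vw]] := cz V (open_nbhs_nbhs (conj Vop Vz)).
  have zw : co z w.
    by rewrite VE; split=> //; apply: closure_sub_G; exact: subset_closure yw.
  by apply: connected_component_trans yw _; exact: connected_component_sym.
apply/seteqP; split=> // z [yz|->]; first exact: subset_closure.
apply: contrapT => xy.
have cy : closure (co y) = co y.
  apply/seteqP; split; last exact: subset_closure.
  by move=> w cw; case: (sub w cw) => // wx; case: xy; rewrite -wx.
have yG : co y = G.
  apply: G_conn.
  - by exists y; exact: connected_component_refl.
  - exact: co_open.
  - exists (co y); first by rewrite -cy; exact: closed_closure.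
    by rewrite setIidr// -{1}cy; exact: closure_sub_G.
by have [_ /(_ erefl)] : W x by apply: (@connected_component_sub _ W y); rewrite -/(co y) yG.
Qed.

Lemma co_x_connected y : W y -> connected (co y `|` [set x]).
Proof.
by move=> Wy; rewrite -closure_co//; apply: connected_closure; exact: component_connected.
Qed.

(* Otherwise the complement of the component in [G] would be a smaller subdendrite
   containing the boundary. *)
Lemma co_boundary y : W y -> exists p, boundary S K p /\ co y p.
Proof.
move=> Wy; apply: contrapT => nP; have [V Vop VE] := co_open y.
pose D := G `&` ~` V.
have Dx : D x.
  split=> // Vx; have : co y x by rewrite VE.
  by move=> /connected_component_sub[_ /(_ erefl)].
have DE z : D z <-> G z /\ ~ co y z.
  by rewrite VE; split=> -[Gz nV]; split=> //; [move=> [_ /nV]|move=> Vz; apply: nV].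
have [Gy _] := Wy; suff /(_ y Gy)/DE[_] : G `<=` D by apply; exact: connected_component_refl.
apply: G_min.
- by exists x.
- by apply: closedI; [exact: G_closed|exact: open_closedC].
- by move=> z [/G_K].
(* [D] is made of [x] and the other components, each of which becomes a connected set through [x]
   when [x] is added. *)
- have -> : D = \bigcup_(z in D) (if z == x then [set x] else co z `|` [set x]).
    apply/seteqP; split=> [z Dz|w [z Dz]].
      exists z => //; case: eqVneq => [//|zx]; left.
      by apply: connected_component_refl; split; [case: Dz|exact/eqP].
    case: eqVneq => [_ ->//|zx] [zw|-> //]; apply/DE; split.
      by case: (connected_component_sub zw).
    move=> yw; move/DE: Dz => [_]; apply.
    by apply: connected_component_trans yw _; exact: connected_component_sym.
  apply: bigcup_connected; first by exists x => z _; case: eqVneq => // _; right.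
  move=> z [Gz _]; case: eqVneq => zx; first exact: connected1.
  by apply: co_x_connected; split=> //; exact/eqP.
- by move=> p Pp; apply/DE; split=> [|yp]; [exact: boundary_G|apply: nP; exists p].
Qed.

Lemma co_continuum p q : co p q ->
  exists E, [/\ closed E, connected E, E p, E q & E `<=` W].
Proof.
rewrite /co WE => pq; apply: (@component_continuum _ _ _ S K) => //.
- exact: G_closed.
- exact: G_K.
- exact: G_conn.
Qed.

(** If [x] were not in the boundary, the finite boundary would lie in the single component, hence in
    a closed connected [E] avoiding [x]; minimality would put [G] inside [E]. *)
Lemma one_component : boundary S K !=set0 -> (forall y z, W y -> W z -> co y z) -> boundary S K x.
Proof.
move=> [y Py] W1; apply: contrapT => Px.
have PW : boundary S K `<=` W.
  by move=> p Pp; split; [exact: boundary_G|move=> px; apply: Px; rewrite -px].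
have Wy := PW _ Py.
have [|||||||E [Ecl Ec Ey PE EW]] := @component_continuum_finite _ _ _ S K S_inj S_contr
  K_attr K_conn K_acyclic bd_fin G U0 y (boundary S K).
- exact: G_closed.
- exact: G_K.
- exact: G_conn.
- exact: U0op.
- by rewrite -WE.
- exact: bd_fin.
- by rewrite -WE => p Pp; apply: W1 => //; exact: PW.
rewrite -WE in EW; have /(_ _ Gx) /EW[_ /(_ erefl)] // : G `<=` E.
apply: G_min => //; first by exists y.
by move=> z /EW[/G_K].
Qed.

(** * Addresses of the point and the components they touch *)

Definition touches a Q := forall n, Q `&` piece S K (word a n) !=set0.

(** Descent along words: [good j] says that [x] is a limit of the part of [co y] in the piece [j].
    One of the finitely many subpieces inherits this, as otherwise the intersection of
    neighbourhoods that refute each of them would refute [good j]. *)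
Lemma touch_exists y : W y -> exists2 a, addresses S K x a & touches a (co y).
Proof.
move=> Wy; pose good j := forall U, open U -> U x -> (co y `&` piece S K j) `&` U !=set0.
have good0 : good [::].
  move=> U Uop Ux; have cx : closure (co y) x by rewrite closure_co//; right.
  have [z [yz Uz]] := cx U (open_nbhs_nbhs (conj Uop Ux)); exists z; split=> //; split=> //.
  by exists z => //; apply: G_K; case: (connected_component_sub yz).
have goodS j : exists i, good j -> good (rcons j i).
  have [gj|gj] := pselect (good j); last first.
    by have [i _] := K_cover K_attr (G_K Gx); exists i.
  apply: contrapT => bad; have /choice[U UP] : forall i, exists U, [/\ open U, U x &
      ~ ((co y `&` piece S K (rcons j i)) `&` U !=set0)].
    move=> i; apply: contrapT => nU; apply: bad; exists i => _ U Uop Ux.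
    by apply: contrapT => h; apply: nU; exists U.
  have [||z [[yz jz] Uz]] := gj (~` \bigcup_(i in [set: 'I_m]) ~` U i).
  - apply: closed_openC; apply: closed_bigcup => [|i _]; first exact: finite_finset.
    by apply: open_closedC; case: (UP i).
  - by move=> [i _]; case: (UP i).
  have [i jiz] := piece_split K_attr jz; have [_ _] := UP i; apply; exists z; split=> //.
  by apply: contrapT => nU; apply: Uz; exists i.
have [nxt nxtP] := choice goodS.
pose w n := iter n (fun j => rcons j (nxt j)) [::]; pose a n := nxt (w n).
have aw n : word a n = w n by elim: n => [|n IH] //; rewrite wordS IH.
have wgood n : good (w n) by elim: n => [|n IH] //=; exact: nxtP.
exists a => [|n]; last first.
  by have [z [yz _]] := wgood n setT openT I; exists z; rewrite aw.
apply/addressP => n; rewrite aw; apply: contrapT => nx.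
have [|z [[_ wz] []]] // := wgood n (~` piece S K (w n)) _ nx.
by apply: closed_openC; exact: piece_closed.
Qed.

(** Take a connected [E] in [W] that meets the pieces of both addresses at a level where they
    differ. Retracting its point [z2] of the piece of [b] onto the piece of [a] stays in [E], and
    also in the piece of [b], which is connected and meets the other piece at [x]. So the result is
    the only common point [x], which [E] avoids. *)
Lemma touch_unique y a b : addresses S K x a -> addresses S K x b ->
  touches a (co y) -> touches b (co y) -> a = b.
Proof.
move=> /addressP ax /addressP bx ay by_; apply: contrapT => ab.
have [n abn] : exists n, word a n != word b n.
  apply: contrapT => nab; apply: ab; apply/funext => n; apply/eqP.
  apply: contrapT => /negP abn; apply: nab; exists n.+1; rewrite !wordS.
  by rewrite eqseq_rcons negb_and abn orbT.
have sz : size (word a n) = size (word b n) by rewrite !size_word.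
have [z1 [yz1 az1]] := ay n; have [z2 [yz2 bz2]] := by_ n.
have [E [Ecl Ec Ez1 Ez2 EW]] : exists E, [/\ closed E, connected E, E z1, E z2 & E `<=` W].
  apply: co_continuum; apply: connected_component_trans yz2.
  exact: connected_component_sym.
have EK : E `<=` K by move=> z /EW[/G_K].
have Er : E (retr (word a n) z2).
  apply: (rho_word_connected S_inj S_contr K_attr K_conn K_acyclic bd_fin) => //.
  by exists z1.
suff rx : retr (word a n) z2 = x by move: Er; rewrite rx => /EW[_ /(_ erefl)].
apply: (pieces_meet sz abn) => //; first by apply: retr_piece; exact: EK.
apply: (rho_word_connected S_inj S_contr K_attr K_conn K_acyclic bd_fin) => //.
- exact: piece_connected.
- by exists x.
Qed.

(* For large [n], two boundary points are retracted to the same point of the piece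
   [word a n] exactly when they have the same mark. *)
Definition mark a p := if `[< W p /\ touches a (co p) >] then co p else [set x].

Lemma co_not_x p : co p = [set x] -> False.
Proof.
move=> px; have : co p x by rewrite px.
by move=> /connected_component_sub[_ /(_ erefl)].
Qed.

(** A touched component is stable under the retractions. An untouched one is so after adding [x]; as
    it misses the pieces from some level on, only [x] is left as the image. *)
Lemma retr_mark a : addresses S K x a -> forall p, boundary S K p ->
  exists n0, forall n, (n0 <= n)%N -> mark a p (retr (word a n) p).
Proof.
move=> ax p Pp; rewrite /mark; have ax' := (addressP _ _).1 ax.
have Gp := boundary_G Pp.
have [->|px] := pselect (p = x).
  exists 0%N => n _; rewrite asboolF; last by move=> [[_ /(_ erefl)]].
  by rewrite /= /retr (@rho_wordK _ _ _ _ _ S_inj K_attr).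
have Wp : W p by split.
have pp : co p p by exact: connected_component_refl.
case: asboolP => [[_ pa]|npa].
  exists 0%N => n _; have [z [pz nz]] := pa n.
  have [E [Ecl Ec Ep Ez EW]] := co_continuum pz.
  have EK : E `<=` K by move=> w /EW[/G_K].
  apply: (@connected_component_max _ W E) => //.
  apply: (rho_word_connected S_inj S_contr K_attr K_conn K_acyclic bd_fin) => //.
  by exists z.
have [n0 n0P] : exists n0, ~ (co p `&` piece S K (word a n0) !=set0).
  by apply: contrapT => h; apply: npa; split=> // n; apply: contrapT => hn; apply: h; exists n.
exists n0 => n n0n.
have cK : co p `|` [set x] `<=` K.
  by move=> z [/connected_component_sub[/G_K]|->] //; exact: G_K.
have : (co p `|` [set x]) (retr (word a n) p).
  apply: (rho_word_connected S_inj S_contr K_attr K_conn K_acyclic bd_fin) => //.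
  - exact: co_x_connected.
  - by exists x; split; [right|].
  - by left.
case=> // pr; case: n0P; exists (retr (word a n) p); split=> //.
by apply: (piece_word_mono K_attr n0n); apply: retr_piece; exact: G_K.
Qed.

(** Two points of one component lie in a closed connected set avoiding [x]. The small pieces at [x]
    miss this set, so it is retracted to a single point. *)
Lemma mark_retr a : addresses S K x a -> forall p q, boundary S K p -> boundary S K q ->
  mark a p = mark a q -> exists n0, forall n, (n0 <= n)%N ->
  retr (word a n) p = retr (word a n) q.
Proof.
move=> ax p q Pp Pq pq.
have [n1 n1P] := retr_mark ax Pp; have [n2 n2P] := retr_mark ax Pq.
move: n1P n2P pq; rewrite /mark.
case: asboolP => [[Wp _]|_]; case: asboolP => [[Wq _]|_] n1P n2P pq.
- have pq' : co p q by rewrite pq; exact: connected_component_refl.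
  have [E [Ecl Ec Ep Eq EW]] := co_continuum pq'.
  have EK : E `<=` K by move=> w /EW[/G_K].
  have nEx : ~ E x by move=> /EW[_ /(_ erefl)].
  have [n0 n0P] := address_small ax (closed_openC Ecl) nEx.
  exists n0 => n n0n; rewrite /retr; congr S_word.
  apply: (rho_word_disjoint S_inj S_contr K_attr K_conn K_acyclic bd_fin EK Ec) => //.
  by move=> [z [Ez nz]]; exact: (n0P n n0n z).
- by case: (co_not_x pq).
- by case: (co_not_x (esym pq)).
- exists (maxn n1 n2) => n; rewrite geq_max => /andP[h1 h2].
  by rewrite (n1P n h1) (n2P n h2).
Qed.

Lemma mark_disjoint a p q z : mark a p z -> mark a q z -> mark a p = mark a q.
Proof.
rewrite /mark; case: asboolP => _; case: asboolP => _ //.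
- by move=> pz qz; rewrite /co (same_connected_component pz) (same_connected_component qz).
- by move=> /connected_component_sub[_ zx] /= zx'; case: zx.
- by move=> /= zx /connected_component_sub[_ zx']; case: zx'.
Qed.

Lemma eventually_mark a : addresses S K x a -> exists n0, forall n, (n0 <= n)%N ->
  forall p q, boundary S K p -> boundary S K q ->
  (phi_word S K (word a n) p = phi_word S K (word a n) q) <-> (mark a p = mark a q).
Proof.
move=> ax; have /finite_seqP[s Ps] := bd_fin.
have /choice[f fP] : forall p, exists n0, boundary S K p ->
    forall n, (n0 <= n)%N -> mark a p (retr (word a n) p).
  move=> p; have [/(retr_mark ax)[n0 n0P]|Pp] := pselect (boundary S K p); first by exists n0.
  by exists 0%N.
have /choice[g gP] : forall pq : X * X, exists n0, boundary S K pq.1 -> boundary S K pq.2 ->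
    mark a pq.1 = mark a pq.2 ->
    forall n, (n0 <= n)%N -> retr (word a n) pq.1 = retr (word a n) pq.2.
  move=> [p q] /=; have [[Pp Pq pq]|h] := pselect [/\ boundary S K p, boundary S K q &
      mark a p = mark a q]; last by exists 0%N => *; case: h.
  by have [n0 n0P] := mark_retr ax Pp Pq pq; exists n0.
(* The boundary being finite, one level serves all its points and all pairs of them. *)
exists (maxn (\max_(p <- s) f p) (\max_(p <- s) \max_(q <- s) g (p, q))) => n.
rewrite geq_max => /andP[fn gn] p q Pp Pq.
have ps : p \in s by move: Pp; rewrite Ps.
have qs : q \in s by move: Pq; rewrite Ps.
have le_max (h : X -> nat) r : r \in s -> (h r <= \max_(u <- s) h u)%N.
  by move=> rs; rewrite (big_rem r)//= leq_maxl.
rewrite !(@phi_word_rho _ _ _ S K)//; split=> [/(congr1 (S_word S (word a n))) pq|pq].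
  apply: (@mark_disjoint _ _ _ (retr (word a n) p)).
    by apply: fP => //; apply: leq_trans fn; exact: le_max.
  by rewrite /retr pq; apply: fP => //; apply: leq_trans fn; exact: le_max.
apply: retr_inj; apply: (gP (p, q)) => //=; apply: leq_trans gn.
apply: leq_trans (le_max (fun p => \max_(q <- s) g (p, q)) p ps).
exact: (le_max (fun q => g (p, q))).
Qed.

End main_tree_components.

(** * Counting components *)

Lemma card_image_kernel (T U V : choiceType) (A : set T) (f : T -> U) (g : T -> V) :
  finite_set A -> (forall p q, A p -> A q -> (f p = f q) <-> (g p = g q)) ->
  #|` fset_set (f @` A)| = #|` fset_set (g @` A)|.
Proof.
move=> Afin fg; have [A0|/set0P[p0 Ap0]] := eqVneq A set0.
  by rewrite A0 !image_set0 !fset_set0.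
pose h u := g (xget p0 [set p | A p /\ f p = u]).
have hf p : A p -> h (f p) = g p.
  move=> Ap; have [|Aq fq] := @xgetPex _ p0 [set q | A q /\ f q = f p]; first by exists p.
  exact/(fg _ _ Aq Ap).
have -> : g @` A = h @` (f @` A).
  apply/seteqP; split=> [_ [p Ap <-]|_ [_ [p Ap <-] <-]].
    by exists (f p); [exists p|rewrite hf].
  by exists p => //; rewrite hf.
rewrite (fset_set_image h (finite_image f Afin)) card_in_imfset//= => u v.
have fA := finite_image f Afin.
rewrite !in_fset_set// => /set_mem[p Ap <-] /set_mem[q Aq <-]; rewrite !hf// => gpq.
exact/(fg _ _ Ap Aq).
Qed.

Lemma sum_card_fibers (T I : choiceType) (A : set T) (B : set I) (r : I -> T -> bool) :
  finite_set A -> finite_set B -> (forall t, A t -> exists2 i, B i & r i t) ->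
  (forall i i' t, B i -> B i' -> A t -> r i t -> r i' t -> i = i') ->
  #|` fset_set A| = (\sum_(i <- fset_set B) #|` fset_set (A `&` [set t | r i t])|)%N.
Proof.
move=> Afin Bfin rex runique.
have cardE i : #|` fset_set (A `&` [set t | r i t])| = (\sum_(t <- fset_set A) r i t)%N.
  have -> : fset_set (A `&` [set t | r i t]) = [fset t in fset_set A | r i t]%fset.
    apply/fsetP => t; rewrite in_fset_set; last exact: finite_setIl.
    rewrite !inE /= in_fset_set//; apply/idP/idP => [/set_mem[At rt]|/andP[/set_mem At rt]].
      by rewrite rt andbT; exact/mem_set.
    exact/mem_set.
  by rewrite card_fset_sum1 /= big_fset /= -big_mkcond.
under eq_bigr do rewrite cardE.
rewrite exchange_big /= card_fset_sum1.
rewrite big_seq [RHS]big_seq; apply: eq_bigr => t; rewrite in_fset_set// => /set_mem At.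
have [i Bi rit] := rex t At.
have iB : i \in fset_set B by rewrite in_fset_set//; exact/mem_set.
rewrite (big_rem i)//= rit big_seq big1 ?addn0// => i'.
rewrite mem_rem_uniq ?fset_uniq// inE => /andP[/= i'i].
rewrite in_fset_set// => /set_mem Bi'; apply/eqP; rewrite eqb0; apply/negP => ri't.
by move/eqP: i'i; apply; exact: runique ri't rit.
Qed.

Section counting.
Context {R : realType} {X : metricType R} {m : nat}.
Variables (S : 'I_m -> X -> X) (K G : set X) (x : X).
Implicit Types (a b : nat -> 'I_m) (p q y z : X) (Q : set X).
Hypothesis S_inj : forall i, injective (S i).
Hypothesis S_contr : forall i, contractive (S i).
Hypothesis K_attr : attractor S K.
Hypothesis K_conn : connected K.
Hypothesis K_acyclic : forall L, simple_closed_curve L -> ~ (L `<=` K).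
Hypothesis bd_fin : finite_set (boundary S K).

Lemma N_phi_eventually a c :
  (exists n0, forall n, (n0 <= n)%N -> card_phi S K a n = c) -> N_phi S K a = c.
Proof.
move=> [n0 n0P]; apply: lim_near_cst; first exact: discrete_hausdorff.
by exists n0.
Qed.

Hypothesis G_main : main_tree S K G.

Lemma A_outside : ~ G x -> A_ S K x = set0.
Proof.
move=> nGx; apply/seteqP; split=> // a [ax].
have [n0 n0P] := outside_constant S_inj S_contr K_attr K_conn K_acyclic bd_fin G_main ax nGx.
suff -> : N_phi S K a = #|` fset_set ((fun=> x) @` boundary S K)|.
  rewrite ltnNge => /negP; apply.
  have /fsubset_leq_card : (fset_set ((fun=> x) @` boundary S K) `<=` [fset x])%fset.
    apply/fsubsetP => y; rewrite in_fset_set; last exact: finite_image.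
    by move=> /set_mem[p _ <-]; rewrite inE.
  by rewrite cardfs1.
apply: N_phi_eventually; exists n0 => n n0n; apply: card_image_kernel => // p q Pp Pq.
split=> // _; rewrite !(@phi_word_rho _ _ _ S K)//; exact: n0P.
Qed.

Hypothesis Gx : G x.
Hypothesis bd2 : exists p q, [/\ boundary S K p, boundary S K q & p <> q].

Let W := G `\ x.
Let comps := components W.

Definition touched a := comps `&` [set Q | `[< touches S K a Q >]].

(* The condition for [x] to be a gate of all the small pieces of the address [a]. *)
Let not_all a := `[< boundary S K x \/ exists2 Q, comps Q & ~ touches S K a Q >].

Lemma comps_boundary Q : comps Q ->
  exists p, [/\ boundary S K p, Q p, W p & Q = connected_component W p].
Proof.
move=> [y Wy <-].
have [p [Pp yp]] := co_boundary S_inj S_contr K_attr K_conn K_acyclic bd_fin G_main Gx Wy.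
exists p; split=> //; first exact: connected_component_sub yp.
exact: same_connected_component.
Qed.

Lemma comps_finite : finite_set comps.
Proof.
apply: sub_finite_set (finite_image (connected_component W) bd_fin) => Q.
by move=> /comps_boundary[p [Pp _ _ ->]]; exists p.
Qed.

Lemma comps_nonempty : comps !=set0.
Proof.
have [p [q [Pp Pq pq]]] := bd2; have [px|px] := pselect (p = x).
  exists (connected_component W q), q => //; split; first exact: (boundary_G G_main).
  by move=> qx; apply: pq; rewrite px qx.
by exists (connected_component W p), p => //; split=> //; exact: (boundary_G G_main).
Qed.

Lemma mark_image a : mark S K G x a @` boundary S K =
  (if not_all a then [set [set x]] else set0) `|` touched a.
Proof.
apply/seteqP; split=> [_ [p Pp <-]|Q].
  rewrite /mark; case: asboolP => [[Wp pa]|np].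
    by right; split; [exists p|apply/asboolP].
  left; rewrite /not_all asboolT//.
  have [<-|px] := pselect (p = x); first by left.
  have Wp : W p by split=> //; exact: (boundary_G G_main).
  by right; exists (connected_component W p); [exists p|move=> pa; apply: np].
case=> [|[/comps_boundary[p [Pp _ Wp ->]] /asboolP pa]]; last first.
  by exists p => //; rewrite /mark asboolT.
rewrite /not_all; case: asboolP => // h ->; case: h => [Px|[Q' /comps_boundary[p [Pp _ Wp ->]] pa]].
  by exists x => //; rewrite /mark asboolF// => -[[_ /(_ erefl)]].
by exists p => //; rewrite /mark asboolF// => -[].
Qed.

Lemma N_phi_touched a : addresses S K x a ->
  N_phi S K a = (not_all a + #|` fset_set (touched a)|)%N.
Proof.
move=> ax; have [n0 n0P] :=
  eventually_mark S_inj S_contr K_attr K_conn K_acyclic bd_fin G_main Gx ax.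
transitivity #|` fset_set (mark S K G x a @` boundary S K)|.
  by apply: N_phi_eventually; exists n0 => n n0n; apply: card_image_kernel => // p q; exact: n0P.
have tfin : finite_set (touched a) by apply: finite_setIl; exact: comps_finite.
rewrite mark_image; case: (not_all a); last by rewrite set0U.
rewrite fset_setU1// cardfsU1 in_fset_set//; congr (_ + _)%N.
apply/eqP; rewrite eqb1; apply/negP => /set_mem[[y Wy yx] _].
have : [set x] x by []; rewrite -yx => /connected_component_sub[_]; exact.
Qed.

(** If [not_all a] holds, the value for [x] adds one to a nonempty set of components. If it fails,
    all components are touched by [a] and [x] is off the boundary, so [one_component] excludes that
    [Q] is the only component. *)
Lemma touched_in_A a Q : addresses S K x a -> comps Q -> touches S K a Q -> A_ S K x a.
Proof.
move=> ax cQ aQ; split=> //; rewrite N_phi_touched//.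
have tfin : finite_set (touched a) by apply: finite_setIl; exact: comps_finite.
have tQ : Q \in fset_set (touched a).
  by rewrite in_fset_set//; apply/mem_set; split=> //; exact/asboolP.
rewrite /not_all; case: asboolP => [_|nall].
  by rewrite ltnS cardfs_gt0; apply/fset0Pn; exists Q.
have Px : ~ boundary S K x by move=> Px; apply: nall; left.
rewrite ltnNge; apply/negP => t1; apply: Px.
have tE Q' : comps Q' -> Q' = Q.
  move=> cQ'; apply/eqP; rewrite eq_sym; apply: contraTT t1 => QQ'.
  have tQ' : Q' \in fset_set (touched a).
    rewrite in_fset_set//; apply/mem_set; split=> //; apply/asboolP.
    by apply: contrapT => aQ'; apply: nall; right; exists Q'.
  have /fsubset_leq_card : ([fset Q; Q'] `<=` fset_set (touched a))%fset.
    by apply/fsubsetP => Z; rewrite !inE => /orP[] /eqP->.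
  by rewrite cardfs2 QQ' -ltnNge.
apply: (one_component S_inj S_contr K_attr K_conn K_acyclic bd_fin G_main Gx).
  by have [p [_ [Pp _ _]]] := bd2; exists p.
move=> y z Wy Wz; have yQ : connected_component W y = Q by apply: tE; exists y.
have zQ : connected_component W z = Q by apply: tE; exists z.
by rewrite -/W yQ -zQ; exact: connected_component_refl.
Qed.

Lemma touched_nonempty a : A_ S K x a -> exists2 Q, comps Q & touches S K a Q.
Proof.
move=> [ax]; rewrite N_phi_touched// => N1; apply: contrapT => nQ.
suff t0 : touched a = set0.
  by move: N1; rewrite t0 fset_set0 cardfs0 addn0; case: (not_all a).
by apply/seteqP; split=> // Q [cQ /asboolP aQ]; apply: nQ; exists Q.
Qed.

Lemma comps_touched Q : comps Q -> exists2 a, A_ S K x a & touches S K a Q.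
Proof.
move=> cQ; have [y Wy yQ] := cQ.
have [a ax ay] := touch_exists S_inj S_contr K_attr K_conn K_acyclic bd_fin G_main Gx Wy.
have aQ : touches S K a Q by rewrite -yQ.
by exists a => //; exact: touched_in_A aQ.
Qed.

Lemma comps_touched_unique a b Q : A_ S K x a -> A_ S K x b -> comps Q ->
  touches S K a Q -> touches S K b Q -> a = b.
Proof.
move=> [ax _] [bx _] [y _ <-].
exact: (touch_unique S_inj S_contr K_attr K_conn K_acyclic bd_fin G_main ax bx).
Qed.

(** Each address in the set touches one of the finitely many components, and the component
    determines the address. *)
Lemma A_finite : finite_set (A_ S K x).
Proof.
have /choice[t tP] : forall Q, exists a, comps Q -> A_ S K x a /\ touches S K a Q.
  move=> Q; have [/comps_touched[a Aa aQ]|nQ] := pselect (comps Q); first by exists a.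
  have [Q' /comps_touched[a _ _]] := comps_nonempty; by exists a.
apply: sub_finite_set (finite_image t comps_finite) => a Aa.
have [Q cQ aQ] := touched_nonempty Aa; exists Q => //.
by have [At tQ] := tP Q cQ; exact: comps_touched_unique aQ.
Qed.

Lemma A_nonempty : A_ S K x !=set0.
Proof. by have [Q /comps_touched[a Aa _]] := comps_nonempty; exists a. Qed.

Lemma Ord_singleton a : A_ S K x = [set a] ->
  (Ord x G + `[< boundary S K x >])%N = N_phi S K a.
Proof.
move=> AE; have [ax _] : A_ S K x a by rewrite AE.
have all_a Q : comps Q -> touches S K a Q.
  by move=> /comps_touched[b]; rewrite AE => ->.
rewrite N_phi_touched// addnC; congr (_ + _)%N.
  congr nat_of_bool; apply: asbool_equiv_eq; split=> [|[//|[Q /all_a aQ //]]]; by left.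
congr (#|` fset_set _|); apply/seteqP; split=> [Q cQ|Q []//].
by split=> //; apply/asboolP; exact: all_a.
Qed.

Lemma Ord_sum : `I_2 #<= A_ S K x ->
  Ord x G = \big[addn/0%N]_(a \in A_ S K x) (N_phi S K a - 1)%N.
Proof.
move=> A2; rewrite fsbig_finite /=; last exact: A_finite.
rewrite /Ord (@sum_card_fibers _ _ _ _ (fun a Q => `[< touches S K a Q >]) comps_finite A_finite).
- rewrite big_seq [RHS]big_seq; apply: eq_bigr => a.
  rewrite in_fset_set; last exact: A_finite.
  move=> /set_mem Aa; have [ax _] := Aa; rewrite N_phi_touched// /not_all asboolT ?addKn//.
  (* A component touched by another address [b] is not touched by [a]. Hence [not_all a] holds and
     accounts for the subtracted 1. *)
  right; have [b Ab ba] : exists2 b, A_ S K x b & b <> a.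
    have [b [c [Ab Ac bc]]] := card_ge2 A2; have [ba|ba] := pselect (b = a); last by exists b.
    by exists c => // ca; apply: bc; rewrite ba ca.
  have [Q cQ bQ] := touched_nonempty Ab; exists Q => // aQ.
  by apply: ba; exact: comps_touched_unique aQ.
- by move=> Q /comps_touched[a Aa aQ]; exists a => //; exact/asboolP.
- by move=> a b Q Aa Ab cQ /asboolP aQ /asboolP bQ; exact: comps_touched_unique aQ bQ.
Qed.

End counting.

Theorem theorem6p5 (R : realType) (X : completeMetricType R) (m : nat)
    (S : 'I_m -> X -> X) (K G : set X)
    (S_inj : forall i, injective (S i))
    (S_contr : forall i, contractive (S i))
    (K_attr : attractor S K)
    (K_dendrite : dendrite K)
    (bd_fin : finite_set (boundary S K))
    (Gamma_reg : regular S K)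
    (G_main : main_tree S K G)
    (x : X) (Kx : K x) :
  [/\ finite_set (A_ S K x),
      A_ S K x = set0 <-> ~ G x,
      forall a, A_ S K x = [set a] -> ~ boundary S K x ->
        Ord x G = N_phi S K a,
      forall a, A_ S K x = [set a] -> boundary S K x ->
        Ord x G = (N_phi S K a - 1)%N
    & `I_2 #<= A_ S K x ->
        Ord x G = \big[addn/0%N]_(a \in A_ S K x) (N_phi S K a - 1)%N].
Proof.
have [[_ _ K_conn] _ K_acyclic] := K_dendrite.
have bd2 := regular_boundary S_inj K_attr Gamma_reg.
have [Gx|nGx] := pselect (G x); last first.
  have A0 := A_outside S_inj S_contr K_attr K_conn K_acyclic bd_fin G_main nGx.
  rewrite A0; split=> //.
  - by move=> a /esym a0; have : [set a] a by []; rewrite a0.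
  - by move=> a /esym a0; have : [set a] a by []; rewrite a0.
  - by move=> /card_ge2[a [b []]].
have OrdE := Ord_singleton S_inj S_contr K_attr K_conn K_acyclic bd_fin G_main Gx bd2.
split.
- exact: (A_finite S_inj S_contr K_attr K_conn K_acyclic bd_fin G_main).
- split=> // A0.
  have [a] := A_nonempty S_inj S_contr K_attr K_conn K_acyclic bd_fin G_main Gx bd2.
  by rewrite A0.
- by move=> a /OrdE <- Px; rewrite asboolF// addn0.
- by move=> a /OrdE <- Px; rewrite asboolT// addn1 subn1.
- exact: (Ord_sum S_inj S_contr K_attr K_conn K_acyclic bd_fin G_main).
Qed.
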